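(* The finite satisfiability problem for $\mathrm{GF}^2_{pres}$ (given a sentence, decide whether it has a finite model) is decidable.
   Context: Structures are over relational signatures with unary and binary relation symbols and equality. The guarded fragment $\mathrm{GF}$ is the smallest set of first-order formulas containing all relational atoms and equalities between variables, closed under Boolean connectives, and such that if $\psi(\bar x,\bar y)\in\mathrm{GF}$ and $\gamma(\bar x,\bar y)$ is a relational atom containing all free variables of $\psi$, then $\forall\bar y\,(\gamma\to\psi)$ and $\exists\bar y\,(\gamma\wedge\psi)$ are in $\mathrm{GF}$. A local Presburger quantifier is an expression $\sum_{i=1}^n\lambda_i\cdot\#^{r_i}_y[\varphi_i(x,y)]\circledast\delta$ with integers $\lambda_i,\delta$, each $r_i$ equal to $R$ or $R^-$ for a binary symbol $R$, and $\circledast\in\{=,\neq,\le,\ge,<,>,\equiv_d,\not\equiv_d\}$ ($d\ge1$, $\equiv_d$ congruence mod $d$); it has free variable $x$, and $\mathcal{M},x/a$ satisfies it iff $\sum_i\lambda_i\cdot|\{b\in M:\mathcal{M}\models r_i(a,b)\wedge\varphi_i(a,b)\}|\circledast\delta$, where $R^-(a,b)$ means $R(b,a)$. $\mathrm{GF}_{pres}$ extends the definition of $\mathrm{GF}$ by closing under local Presburger quantifiers whose subformulas $\varphi_i(x,y)$ are themselves formulas of the logic with free variables among $x,y$. $\mathrm{GF}^2_{pres}$ is its fragment using only the variables $x,y$. *)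

(* Defs.v *)
From HB Require Import structures.
From mathcomp Require Import all_boot all_order all_algebra.

Set Implicit Arguments.
Unset Strict Implicit.
Unset Printing Implicit Defensive.

Import Order.TTheory GRing.Theory Num.Theory.

Inductive var := vx | vy.

Definition veq (v w : var) : bool :=
  match v, w with vx, vx | vy, vy => true | _, _ => false end.

Definition other (v : var) : var := match v with vx => vy | vy => vx end.

Inductive atom := AUn (P : nat) (v : var) | ABin (R : nat) (v w : var).

Inductive cmp := CEq | CNe | CLe | CGe | CLt | CGt | CCong (d : nat) | CNCong (d : nat).

(* Formulas.  FEx qx qy a f  is  exists ybar (a /\ f), where ybar consists of
   x if qx and of y if qy; FAll qx qy a f is forall ybar (a -> f).
   FPres v ts c delta is the local Presburger quantifier
     sum_i lam_i * #^{r_i}_{other v} [f_i] (c) delta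
   with free variable v and counted variable (other v); the term list
   ts = SCons lam R inv f ... records lam_i, the binary symbol R,
   whether r_i = R^- (inv = true) or R (inv = false), and f_i. *)
Inductive fml :=
| FAtom (a : atom)
| FEq (v w : var)
| FNeg (f : fml)
| FAnd (f g : fml)
| FOr (f g : fml)
| FEx (qx qy : bool) (a : atom) (f : fml)
| FAll (qx qy : bool) (a : atom) (f : fml)
| FPres (v : var) (ts : sterm) (c : cmp) (delta : int)
with sterm :=
| SNil
| SCons (lam : int) (R : nat) (inv : bool) (f : fml) (ts : sterm).

Definition avars (a : atom) (v : var) : bool :=
  match a with AUn _ w => veq v w | ABin _ w1 w2 => veq v w1 || veq v w2 end.

Definition quant (qx qy : bool) (v : var) : bool :=
  match v with vx => qx | vy => qy end.

Fixpoint fv (f : fml) (v : var) : bool :=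
  match f with
  | FAtom a => avars a v
  | FEq w1 w2 => veq v w1 || veq v w2
  | FNeg g => fv g v
  | FAnd g h => fv g v || fv h v
  | FOr g h => fv g v || fv h v
  | FEx qx qy a g => ~~ quant qx qy v && (avars a v || fv g v)
  | FAll qx qy a g => ~~ quant qx qy v && (avars a v || fv g v)
  | FPres w _ _ _ => veq v w
  end.

Definition cmp_ok (c : cmp) : bool :=
  match c with CCong d | CNCong d => (0 < d)%N | _ => true end.

Fixpoint gf2 (f : fml) : bool :=
  match f with
  | FAtom _ | FEq _ _ => true
  | FNeg g => gf2 g
  | FAnd g h | FOr g h => gf2 g && gf2 h
  | FEx _ _ a g | FAll _ _ a g =>
      [&& gf2 g, fv g vx ==> avars a vx & fv g vy ==> avars a vy]
  | FPres _ ts c _ => gf2ts ts && cmp_ok c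
  end
with gf2ts (ts : sterm) : bool :=
  match ts with
  | SNil => true
  | SCons _ _ _ g r => gf2 g && gf2ts r
  end.

Definition gf2_sentence (f : fml) : bool := [&& gf2 f, ~~ fv f vx & ~~ fv f vy].

Section Semantics.
Local Open Scope ring_scope.
Variables (M : finType) (U : nat -> M -> bool) (B : nat -> M -> M -> bool).

Definition upd (s : var -> M) (v : var) (m : M) : var -> M :=
  fun w => if veq w v then m else s w.

Definition qupd (qx qy : bool) (s : var -> M) (u w : M) : var -> M :=
  fun v => match v with vx => if qx then u else s vx
                      | vy => if qy then w else s vy end.

Definition asat (a : atom) (s : var -> M) : bool :=
  match a with AUn P v => U P (s v) | ABin R v w => B R (s v) (s w) end.

Definition cmp_holds (c : cmp) (n d : int) : bool :=
  match c with
  | CEq => n == d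
  | CNe => n != d
  | CLe => n <= d
  | CGe => n >= d
  | CLt => n < d
  | CGt => n > d
  | CCong k => (n == d %[mod k%:Z])%Z
  | CNCong k => (n != d %[mod k%:Z])%Z
  end.

Fixpoint sat (f : fml) (s : var -> M) : bool :=
  match f with
  | FAtom a => asat a s
  | FEq v w => s v == s w
  | FNeg g => ~~ sat g s
  | FAnd g h => sat g s && sat h s
  | FOr g h => sat g s || sat h s
  | FEx qx qy a g =>
      [exists u : M, [exists w : M,
         asat a (qupd qx qy s u w) && sat g (qupd qx qy s u w)]]
  | FAll qx qy a g =>
      [forall u : M, [forall w : M,
         asat a (qupd qx qy s u w) ==> sat g (qupd qx qy s u w)]]
  | FPres v ts c d => cmp_holds c (tsum v ts s) d
  end
with tsum (v : var) (ts : sterm) (s : var -> M) : int :=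
  match ts with
  | SNil => 0
  | SCons lam R inv g r =>
      lam * (#|[pred b : M | (if inv then B R b (s v) else B R (s v) b)
                             && sat g (upd s (other v) b)]|)%:Z
      + tsum v r s
  end.

End Semantics.

Definition fin_sat (f : fml) : Prop :=
  exists (M : finType) (m0 : M) (U : nat -> M -> bool) (B : nat -> M -> M -> bool),
    sat U B f (fun _ => m0).

Definition cpair (a b : nat) : nat := ((a + b) * (a + b).+1) %/ 2 + b.

Definition code_var (v : var) : nat := match v with vx => 0 | vy => 1 end.
Definition code_bool (b : bool) : nat := if b then 1 else 0.
Definition code_int (z : int) : nat :=
  match z with Posz n => n.*2 | Negz n => n.*2.+1 end.
Definition code_atom (a : atom) : nat :=
  match a with
  | AUn P v => cpair 0 (cpair P (code_var v))
  | ABin R v w => cpair 1 (cpair R (cpair (code_var v) (code_var w)))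
  end.
Definition code_cmp (c : cmp) : nat :=
  match c with
  | CEq => cpair 0 0 | CNe => cpair 1 0 | CLe => cpair 2 0 | CGe => cpair 3 0
  | CLt => cpair 4 0 | CGt => cpair 5 0 | CCong d => cpair 6 d | CNCong d => cpair 7 d
  end.

Fixpoint code (f : fml) : nat :=
  match f with
  | FAtom a => cpair 0 (code_atom a)
  | FEq v w => cpair 1 (cpair (code_var v) (code_var w))
  | FNeg g => cpair 2 (code g)
  | FAnd g h => cpair 3 (cpair (code g) (code h))
  | FOr g h => cpair 4 (cpair (code g) (code h))
  | FEx qx qy a g =>
      cpair 5 (cpair (code_bool qx) (cpair (code_bool qy) (cpair (code_atom a) (code g))))
  | FAll qx qy a g =>
      cpair 6 (cpair (code_bool qx) (cpair (code_bool qy) (cpair (code_atom a) (code g))))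
  | FPres v ts c d =>
      cpair 7 (cpair (code_var v) (cpair (code_ts ts) (cpair (code_cmp c) (code_int d))))
  end
with code_ts (ts : sterm) : nat :=
  match ts with
  | SNil => 0
  | SCons lam R inv g r =>
      (cpair (code_int lam) (cpair R (cpair (code_bool inv) (cpair (code g) (code_ts r))))).+1
  end.

Inductive rf :=
| RZero
| RSucc
| RProj (i : nat)
| RComp (f : rf) (gs : list rf)
| RPrec (f g : rf)
| RMu (f : rf).

Inductive eval : rf -> seq nat -> nat -> Prop :=
| eZero xs : eval RZero xs 0
| eSucc xs : eval RSucc xs (head 0 xs).+1
| eProj i xs : eval (RProj i) xs (nth 0 xs i)
| eComp f gs xs ys y : evals gs xs ys -> eval f ys y -> eval (RComp f gs) xs y
| ePrec0 f g xs y : eval f xs y -> eval (RPrec f g) (0 :: xs) y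
| ePrecS f g n xs r y :
    eval (RPrec f g) (n :: xs) r -> eval g (n :: r :: xs) y ->
    eval (RPrec f g) (n.+1 :: xs) y
| eMu f xs n :
    eval f (n :: xs) 0 ->
    (forall m, (m < n)%N -> exists k, eval f (m :: xs) k.+1) ->
    eval (RMu f) xs n
with evals : seq rf -> seq nat -> seq nat -> Prop :=
| esNil xs : evals [::] xs [::]
| esCons g gs xs y ys : eval g xs y -> evals gs xs ys -> evals (g :: gs) xs (y :: ys).

(* Main.v *)
From HB Require Import structures.
Require Import Defs.
From mathcomp Require Import all_boot all_order all_fingroup all_algebra.
From mathcomp Require Import zify ring lra.

Set Implicit Arguments.
Unset Strict Implicit.
Unset Printing Implicit Defensive.

Import Order.TTheory GRing.Theory Num.Theory.

(** A finite model can be replaced by one of computable size, so that brute-force search decides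
    the problem.  Each element [a] is described by the multiset of 2-types of its guarded pairs.
    A Presburger constraint at [a], once the sign of its value and its residue are fixed, becomes
    with slack variables a zero-sum condition on a sequence of integer vectors, and a zero-sum
    sequence of bounded vectors splits into zero-sum pieces of bounded length.  Hence the multiset
    of [a] is a bounded base plus bounded periods, and any number of periods may be added to or
    removed from the base without affecting the constraints.  The requirement that every 2-type
    occurs as often as its converse is again a zero-sum condition, now on the bases and periods of
    all elements; a few of its pieces already give a balanced system of bounded size in which all
    classes of elements are represented.  Periods only depend on the class, so they can be hosted
    by any element of it.  A balanced system is finally realized by a graph without multiple
    edges: non-adjacent pairs carry no binary atom and are invisible to guarded formulas. *)

(** * Zero-sum sequences of integer vectors *)

Local Open Scope ring_scope.

(** Neighbourhoods cannot be shrunk one element at a time, because each occurrence of a 2-type at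
    one end of an edge is an occurrence of the converse type at the other end. Cutting every
    neighbourhood into base and periods lets the local constraints and the global balance be treated
    by the same zero-sum lemma, applied twice. The sign is fixed together with the residue because a
    period then moves the value away from zero by a multiple of the modulus, so comparisons and
    congruences survive alike. A 2-type records the truth of all subformulas, not only of atoms.
    Nested counting therefore needs no normal form: a Presburger subformula becomes a linear
    condition whose coefficients are read off the types, and truth in the new structure is compared
    with the old one by induction. The bound for zero-sum pieces is roughly squared with each
    coordinate, hence doubly exponential in the dimension; only its computability matters. *)

Lemma ltr_sum_seq0 (I : eqType) (w : I -> int) (s : seq I) :
  (forall i, i \in s -> w i < 0) -> (0 < size s)%N -> \sum_(i <- s) w i < 0.
Proof.
case: s => // i s neg _; rewrite big_cons.
have /= wi := neg i (mem_head _ _).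
suff le0 : \sum_(j <- s) w j <= 0 by apply: ltr_wnDr wi.
rewrite big_seq; apply: sumr_le0 => j js; apply/ltW/neg.
by rewrite inE js orbT.
Qed.

(** If every item pulled strictly to the side of [c], the total could not vanish. The case [c = 0]
    asks for a nonnegative item. *)
Lemma exists_opposite_sign (I : eqType) (w : I -> int) (s : seq I) (c : int) :
  c + \sum_(i <- s) w i = 0 -> (0 < size s)%N ->
  exists2 i, i \in s & (c <= 0 -> 0 <= w i) /\ (0 < c -> w i <= 0).
Proof.
move=> sum0 sz; case: (lerP c 0) => c0.
- have [/hasP[i si wi]|/hasPn h] := boolP (has (fun i => 0 <= w i) s).
    by exists i.
  have : \sum_(i <- s) w i < 0.
    by apply: ltr_sum_seq0 => // i /h; rewrite -ltNge.
  lia.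
- have [/hasP[i si wi]|/hasPn h] := boolP (has (fun i => w i <= 0) s).
    by exists i.
  have : 0 < \sum_(i <- s) w i.
    rewrite -oppr_lt0 -sumrN.
    by apply: ltr_sum_seq0 => // i /h; rewrite -ltNge oppr_lt0.
  lia.
Qed.

(* Always take next an item whose sign is opposite to that of the current partial sum. *)
Lemma greedy_prefix_bound (I : eqType) (w : I -> int) (E : int) :
  forall (s : seq I) (c : int), (forall i, i \in s -> `|w i| <= E) ->
  `|c| <= E -> c + \sum_(i <- s) w i = 0 ->
  exists2 s', perm_eq s' s &
    forall k, `|c + \sum_(i <- take k s') w i| <= E.
Proof.
move=> s; move: {2}(size s) (erefl (size s)) => n.
elim: n s => [|n IHn] s sz c bw bc sum0.
  exists [::]; first by rewrite (size0nil sz).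
  by move=> k; rewrite big_nil addr0.
have [|i si wi] := exists_opposite_sign sum0; first by rewrite sz.
have pr := perm_to_rem si.
have bwi := bw i si.
have [||||s' ps' bs'] := IHn (rem i s) _ (c + w i).
- by rewrite size_rem // sz.
- by move=> j /mem_rem; exact: bw.
- by case: (lerP c 0) wi => c0 [h1 h2]; [have := h1 isT | have := h2 isT]; lia.
- by move: sum0; rewrite (perm_big _ pr) big_cons addrA.
exists (i :: s'); first by rewrite perm_sym (perm_trans pr) // perm_cons perm_sym.
case=> [|k]; first by rewrite big_nil addr0.
by rewrite /= big_cons addrA; exact: bs'.
Qed.

(** Pigeonhole: the partial sums of the greedy order take at most [2 * E + 1] values, so two of the
    first [2 * E + 2] coincide, and the segment between them sums to zero. *)
Lemma zero_sum_piece (I : eqType) (w : I -> int) (E : nat) (s : seq I) :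
  (forall i, i \in s -> `|w i| <= E%:Z) -> \sum_(i <- s) w i = 0 ->
  (0 < size s)%N ->
  exists p r : seq I, [/\ perm_eq (p ++ r) s, (0 < size p <= 2 * E + 1)%N &
     \sum_(i <- p) w i = 0].
Proof.
move=> bw sum0 sz.
have [||s' ps' bs'] := @greedy_prefix_bound _ w E s 0 bw; rewrite ?add0r //.
have [le|gt] := leqP (size s) (2 * E + 1).
  by exists s, [::]; rewrite cats0 perm_refl sz le.
pose P k : int := \sum_(i <- take k s') w i.
have bP k : `|P k| <= E%:Z by have := bs' k; rewrite add0r.
(* Partial sums are shifted from the interval [-E, E] to naturals below [2 * E + 1]. *)
pose g (k : 'I_(2 * E + 2)) : 'I_(2 * E).+1 := inord (absz (P k + E%:Z)).
have gE k : (nat_of_ord (g k))%:Z = P k + E%:Z.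
  have := bP k => b; rewrite inordK; lia.
have : ~~ injectiveb g.
  apply/negP => /injectiveP /leq_card; rewrite !card_ord; lia.
rewrite /injectiveb /dinjectiveb => /injectivePn[x [y xy gxy]].
wlog ltxy : x y xy gxy / (x < y)%N.
  move=> H; case: (ltngtP x y) => xy'; first exact: (H x y).
    by apply: (H y x); rewrite // eq_sym.
  by case/eqP: xy; apply: val_inj.
have Pxy : P x = P y by have := gE x; have := gE y; rewrite gxy; lia.
have ys : (y <= size s')%N by rewrite (perm_size ps'); have := ltn_ord y; lia.
have split3 : s' = take x s' ++ drop x (take y s') ++ drop y s'.
  rewrite catA -{1}(cat_take_drop y s'); congr (_ ++ _).
  by rewrite -{1}(cat_take_drop x (take y s')) take_takel // ltnW.
exists (drop x (take y s')), (take x s' ++ drop y s'); split.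
- by rewrite -(permPr ps') {4}split3 perm_catCA.
- by rewrite size_drop size_takel //; have := ltn_ord y; lia.
- have : P y = P x + \sum_(i <- drop x (take y s')) w i.
    rewrite /P -{1}(cat_take_drop x (take y s')) take_takel ?(ltnW ltxy) //.
    by rewrite big_cat.
  by rewrite Pxy -[X in X = _ -> _]addr0 => /addrI.
Qed.

Lemma zero_sum_split1 (I : eqType) (w : I -> int) (E : nat) (s : seq I) :
  (forall i, i \in s -> `|w i| <= E%:Z) -> \sum_(i <- s) w i = 0 ->
  exists2 ss : seq (seq I), perm_eq (flatten ss) s &
    forall p, p \in ss -> (size p <= 2 * E + 1)%N /\ \sum_(i <- p) w i = 0.
Proof.
move: {2}(size s).+1 (ltnSn (size s)) => n.
elim: n s => // n IHn s sz bw sum0.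
have [s0|spos] := posnP (size s).
  by exists [::]; rewrite ?(size0nil s0).
have [p [r [pr /andP[p0 pE] psum]]] := zero_sum_piece bw sum0 spos.
have [|||ss pss hss] := IHn r.
- by move: (perm_size pr) sz; rewrite size_cat; lia.
- by move=> i ir; apply: bw; rewrite -(perm_mem pr) mem_cat ir orbT.
- by move: sum0; rewrite -(perm_big _ pr) big_cat /= psum add0r.
exists (p :: ss).
  by rewrite /= (perm_trans _ pr) // perm_cat2l.
by move=> q; rewrite inE => /orP[/eqP->|/hss].
Qed.

Lemma size_flatten_le (I : eqType) (ss : seq (seq I)) (N : nat) :
  (forall p, p \in ss -> (size p <= N)%N) -> (size (flatten ss) <= size ss * N)%N.
Proof.
elim: ss => //= p ss IHss h; rewrite size_cat mulSn leq_add //.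
  by apply: h; rewrite mem_head.
by apply: IHss => q qss; apply: h; rewrite inE qss orbT.
Qed.

(* One coordinate at a time: the pieces for the first [d] coordinates are regrouped so that
   the last one vanishes as well. *)
Fixpoint zs_bound (d E : nat) : nat :=
  if d is d'.+1 then zs_bound d' E * (2 * (zs_bound d' E * E) + 1) else 1.

Lemma normr_sum_seq_le (I : eqType) (w : I -> int) (E : nat) (s : seq I) :
  (forall i, i \in s -> `|w i| <= E%:Z) ->
  `|\sum_(i <- s) w i| <= (size s * E)%:Z.
Proof.
elim: s => [|i s IHs] bw; first by rewrite big_nil.
rewrite big_cons /= mulSn PoszD; apply: le_trans (ler_normD _ _) _.
apply: lerD; first by apply: bw; rewrite mem_head.
by apply: IHs => j js; apply: bw; rewrite inE js orbT.
Qed.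

Lemma zero_sum_split (I : eqType) (w : nat -> I -> int) (d E : nat) (s : seq I) :
  (forall i, i \in s -> forall k, (k < d)%N -> `|w k i| <= E%:Z) ->
  (forall k, (k < d)%N -> \sum_(i <- s) w k i = 0) ->
  exists2 ss : seq (seq I), perm_eq (flatten ss) s &
    forall p, p \in ss -> (size p <= zs_bound d E)%N /\
      forall k, (k < d)%N -> \sum_(i <- p) w k i = 0.
Proof.
elim: d => [|d IHd] bw sum0.
  exists [seq [:: i] | i <- s]; last by move=> p /mapP[i _ ->].
  by rewrite (_ : flatten _ = s) //; elim: s {bw sum0} => //= i s ->.
have [||ss pss hss] := IHd.
- by move=> i si k kd; apply: bw => //; lia.
- by move=> k kd; apply: sum0; lia.
have [||sss psss hsss] :=
    @zero_sum_split1 _ (fun p => \sum_(i <- p) w d i) (zs_bound d E * E) ss.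
- move=> p pss'; have [sp _] := hss p pss'.
  apply: le_trans (@normr_sum_seq_le _ (w d) E p _) _.
    move=> i ip; apply: bw => //; rewrite -(perm_mem pss).
    by apply/flattenP; exists p.
  by rewrite lez_nat leq_mul2r sp orbT.
- by rewrite -big_flatten (perm_big _ pss) sum0.
exists (map flatten sss).
  rewrite -(permPr pss) (_ : flatten (map _ _) = flatten (flatten sss)).
    exact: perm_flatten.
  by elim: sss {psss hsss} => //= a l ->; rewrite flatten_cat.
move=> q /mapP[pp ppsss ->]; have [szpp sumpp] := hsss _ ppsss.
have inss p : p \in pp -> p \in ss.
  by move=> ip; rewrite -(perm_mem psss); apply/flattenP; exists pp.
split.
  apply: leq_trans (size_flatten_le (N := zs_bound d E) _) _.
    by move=> p /inss /hss[].
  by rewrite mulnC leq_mul2l szpp orbT.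
move=> k; rewrite ltnS leq_eqVlt big_flatten => /orP[/eqP->//|kd].
by rewrite big_seq big1 // => p /inss /hss[_]; apply.
Qed.

Local Close Scope ring_scope.

(** * Realizing balanced degree sequences *)

(** Equal fibre sizes make the two codomain tuples permutations of each other; the permutation of
    positions, read through [enum_rank], is [sigma]. *)
Lemma equidistributed_bijection (X : finType) (T : eqType) (f g : X -> T) :
  (forall t, #|[pred x | f x == t]| = #|[pred x | g x == t]|) ->
  exists2 sigma : X -> X, bijective sigma & forall x, g (sigma x) = f x.
Proof.
move=> fg.
have cntE (h : X -> T) t : count_mem t (codom h) = #|[pred x | h x == t]|.
  by rewrite /codom /image_mem count_map cardE -size_filter /enum_mem -filter_predI; congr (size _); apply: eq_filter => x; rewrite !inE andbT.
have /tuple_permP[p pE] : perm_eq (codom_tuple f) (codom_tuple g).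
  by apply/allP => t _ /=; rewrite !cntE fg.
exists (fun x => enum_val (p (enum_rank x))).
  exists (fun x => enum_val ((p^-1)%g (enum_rank x))) => x.
    by rewrite enum_valK permK enum_rankK.
  by rewrite enum_valK permKV enum_rankK.
have tn (h : X -> T) i : tnth (codom_tuple h) i = h (enum_val i).
  by rewrite (tnth_nth (h (enum_val i))) /= /codom /image_mem (nth_map (enum_val i)) -?cardE ?ltn_ord // -(enum_val_nth (enum_val i)).
move=> x; rewrite -[in RHS](enum_rankK x) -!tn.
rewrite -(tnth_mktuple (fun i => tnth (codom_tuple g) (p i)) (enum_rank x)).
by congr (tnth _ _); apply: val_inj; rewrite /= -pE.
Qed.

Section Realization.
Variables (T : finType) (sw : T -> T) (swK : involutive sw).
Variables (V0 : finType) (F : V0 -> seq T).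
Hypothesis bal : forall t,
  \sum_v count_mem t (F v) = \sum_v count_mem (sw t) (F v).

Let X : finType := {v : V0 & 'I_(size (F v))}.
Let ty (x : X) : T := tnth (in_tuple (F (tag x))) (tagged x).

Lemma sum_dart (P : pred V0) (t : T) :
  #|[pred x : X | P (tag x) && (ty x == t)]| = \sum_(v | P v) count_mem t (F v).
Proof.
under eq_bigr => v _ do rewrite -sum1_count big_tnth.
by rewrite -sum1_card sig_big_dep.
Qed.

(* A dart is an occurrence of a type at a vertex.  Darts are matched with darts of the converse
   type by a bijection [sigma], and [x] joins [(tag x, false, g)] to [(tag (sigma x), true, g + sh x)];
   the shifts [sh x] are distinct, so no two darts yield the same edge. *)
Lemma balanced_realization :
  exists (V : finType) (pr : V -> V0) (lab : V -> V -> option T),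
  [/\ forall v, exists u, pr u = v,
      forall u w, lab w u = omap sw (lab u w),
      forall u, lab u u = None,
      forall u t, #|[pred w | lab u w == Some t]| = count_mem t (F (pr u)) &
      #|V| = #|V0| * 2 * (\sum_v size (F v)).+1].
Proof.
have cardX : #|X| = \sum_v size (F v).
  by rewrite card_tagged sumnE big_map big_enum; apply: eq_bigr => v _; rewrite card_ord.
have [sigma sbij sE] :
  exists2 sigma : X -> X, bijective sigma & forall x, ty (sigma x) = sw (ty x).
  apply: (@equidistributed_bijection X T (fun x => sw (ty x)) ty) => t.
  have -> : #|[pred x | sw (ty x) == t]| = #|[pred x : X | predT (tag x) && (ty x == sw t)]|.
    by apply: eq_card => x; rewrite !inE /= (can2_eq swK swK).
  have -> : #|[pred x | ty x == t]| = #|[pred x : X | predT (tag x) && (ty x == t)]|.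
    by apply: eq_card => x; rewrite !inE.
  by rewrite !sum_dart -bal.
have sinj := bij_inj sbij.
(* Copies of a vertex are indexed by the cyclic group of order [#|X|.+1]; the successor provides the
   addition even when there are no darts. *)
pose sh (x : X) : 'I_(#|X|).+1 := lift ord0 (enum_rank x).
have shI : injective sh by move=> x y /lift_inj /enum_rank_inj.
pose dart v (g : 'I_(#|X|).+1) w h :=
  [pick x : X | [&& tag x == v, tag (sigma x) == w & (g + sh x)%R == h]].
have dartE x g : dart (tag x) g (tag (sigma x)) (g + sh x)%R = Some x.
  rewrite /dart; case: pickP => [y /and3P[_ _ /eqP/addrI/shI->//]|/(_ x)].
  by rewrite !eqxx.
have dartP v g w h x : dart v g w h = Some x ->
    [/\ tag x = v, tag (sigma x) = w & (g + sh x)%R = h].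
  by rewrite /dart; case: pickP => // y /and3P[/eqP ? /eqP ? /eqP ?] [<-].
(* Edges run only between the [false] and the [true] side, so no loop arises even when [sigma] fixes
   a dart or matches two darts of one vertex. *)
pose lab (u w : V0 * bool * 'I_(#|X|).+1) : option T :=
  match u.1.2, w.1.2 with
  | false, true => omap ty (dart u.1.1 u.2 w.1.1 w.2)
  | true, false => omap (fun x => sw (ty x)) (dart w.1.1 w.2 u.1.1 u.2)
  | _, _ => None
  end.
exists (V0 * bool * 'I_(#|X|).+1)%type, (fun u => u.1.1), lab; split.
- by move=> v; exists (v, true, ord0).
- move=> [[u []] g] [[w []] h]; rewrite /lab //=; case: (dart _ _ _ _) => //= x.
  by rewrite swK.
- by move=> [[u []] g].
- move=> [[u []] g] t /=.
  (* On the [true] side the darts at [u] appear as images [sigma x], so the count is reindexed along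
     [sigma]. *)
  + rewrite -(big_pred1_eq addn u (fun v => count_mem t (F v))) -sum_dart.
    have -> : #|[pred x : X | (tag x == u) && (ty x == t)]| =
      #|[pred x : X | (tag (sigma x) == u) && (ty (sigma x) == t)]|.
      rewrite -!sum1_card (reindex sigma) //; exact: onW_bij.
    have finj : injective (fun x => (tag x, false, (g - sh x)%R)).
      by move=> x y /(congr1 snd) /= /addrI /oppr_inj /shI.
    rewrite -[RHS](card_image finj); apply: eq_card => -[[w b] h]; rewrite !inE /lab /=.
      apply/idP/imageP => [|[x]]; rewrite ?inE /=.
        case: b => //; case E: (dart _ _ _ _) => [x|] //= /eqP[xt].
        have [<- <- <-] := dartP _ _ _ _ _ E.
        by exists x; rewrite ?inE /= ?eqxx ?sE ?xt ?eqxx // addrK.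
      move=> /andP[/eqP <- /eqP <-] [-> -> ->].
      by rewrite -{2}(subrK (sh x) g) dartE /= sE.
  + rewrite -(big_pred1_eq addn u (fun v => count_mem t (F v))) -sum_dart.
    have finj : injective (fun x => (tag (sigma x), true, (g + sh x)%R)).
      by move=> x y /(congr1 snd) /= /addrI /shI.
    rewrite -[RHS](card_image finj); apply: eq_card => -[[w b] h]; rewrite !inE /lab /=.
      apply/idP/imageP => [|[x]]; rewrite ?inE /=.
        case: b => //; case E: (dart _ _ _ _) => [x|] //= /eqP[xt].
        have [<- <- <-] := dartP _ _ _ _ _ E.
        by exists x; rewrite ?inE /= ?eqxx ?xt ?eqxx.
      by move=> /andP[/eqP <- /eqP <-] [-> -> ->]; rewrite dartE.
- by rewrite !card_prod card_bool card_ord cardX.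
Qed.
End Realization.

(** * Base and periods of one element *)

Local Open Scope ring_scope.

(** Serves to form the base: from all zero-sum pieces it selects a few that together contain the
    constant term and each occurring type. *)
Lemma extract_marked (I K : eqType) (ss : seq I) (ks : seq K) (P : K -> pred I) :
  (forall k, k \in ks -> has (P k) ss) ->
  exists A B : seq I, [/\ perm_eq (A ++ B) ss, (size A <= size ks)%N &
    forall k, k \in ks -> has (P k) A].
Proof.
elim: ks => [|k ks IHks] h; first by exists [::], ss.
have [|A [B [pAB sA hA]]] := IHks.
  by move=> k' kks; apply: h; rewrite inE kks orbT.
have /hasP[x xss Px] := h k (mem_head _ _).
move: xss; rewrite -(perm_mem pAB) mem_cat => /orP[xA|xB].
  exists A, B; split=> //; first by apply: leq_trans sA _ => /=.
  by move=> k'; rewrite inE => /orP[/eqP->|/hA //]; apply/hasP; exists x.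
exists (x :: A), (rem x B); split=> //.
- rewrite -(permPr pAB) /= -cat1s perm_catCA perm_cat2l.
  by rewrite perm_sym; apply: perm_to_rem.
- by move=> k'; rewrite inE => /orP[/eqP->|/hA] /=; [rewrite Px|move=> ->; rewrite orbT].
Qed.

Section LocalDecomposition.
Variables (T : finType) (J E : nat) (L : nat -> T -> int) (d : nat -> nat).
Hypothesis L_le : forall j t, (j < J)%N -> `|L j t| <= E%:Z.
Hypothesis d_gt0 : forall j, (0 < d j)%N.
Hypothesis d_le : forall j, (j < J)%N -> (d j <= E)%N.

(** At most [#|T|.+1] pieces form the base, one for the constant term and one per type. The items
    are bounded by [2 * E] because the constant term [c j - e j * r j] combines two quantities
    bounded by [E]. *)
Definition local_bound : nat := #|T|.+1 * zs_bound J (2 * E).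

(* [inl t] is a neighbour, [inr None] the constant term, and [inr (Some j)] a
   slack step of length [d j] for the j-th constraint. *)
Let item : eqType := (T + option nat)%type.
Let neighbours (p : seq item) : seq T :=
  pmap (fun i => if i is inl t then Some t else None) p.
Let consts (p : seq item) : nat := count_mem (inr None : item) p.
Let slacks (j : nat) (p : seq item) : nat := count_mem (inr (Some j) : item) p.

(** Write the value of constraint j as e(r + q d), with e its sign. Then the constant c - e r, the
    neighbours, and q slack steps -d e sum to zero, in all constraints at once. A piece without the
    constant is a period: its neighbours contribute a multiple of d e. The pieces put into the base
    leave the value e(r + k d), of the same sign. *)
Lemma local_decomposition (s : seq T) (c : nat -> int) (e := fun j =>
    sgz (c j + \sum_(t <- s) L j t)) :
  (forall j, (j < J)%N -> `|c j| <= E%:Z) ->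
  exists base ps,
  [/\ perm_eq (base ++ flatten ps) s,
      forall p, p \in base :: ps -> (size p <= local_bound)%N,
      {subset s <= base},
      forall j, (j < J)%N -> sgz (c j + \sum_(t <- base) L j t) = e j &
      forall p j, p \in ps -> (j < J)%N ->
        exists k : nat, \sum_(t <- p) L j t = (k * d j)%:Z * e j].
Proof.
move=> c_le.
pose v j : nat := absz (c j + \sum_(t <- s) L j t).
(* The residue is taken in 1..d rather than 0..d-1, so that r + k d is positive and the base keeps
   the sign. When the value is 0 this gives r = 1 and q = 0, and the factor e = 0 hides it. *)
pose r j := ((v j).-1 %% d j)%N.+1; pose q j := ((v j).-1 %/ d j)%N.
have vE j : c j + \sum_(t <- s) L j t = e j * (r j + q j * d j)%:Z.
  rewrite {1}[LHS]intEsg -/(v j) -/(e j).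
  have [v0|v0] := posnP (v j).
    have -> : e j = 0 by rewrite /e; move: v0; rewrite /v; lia.
    by rewrite !mul0r.
  congr (_ * _%:Z); have := divn_eq (v j).-1 (d j); rewrite /r /q; lia.
have r_le j : (r j <= d j)%N by rewrite /r ltn_mod.
have e_le j : `|e j| <= 1 by rewrite /e; case: sgzP.
pose w j (i : item) : int := match i with
  | inl t => L j t
  | inr None => c j - e j * (r j)%:Z
  | inr (Some i) => if i == j then - ((d j)%:Z * e j) else 0
  end.
have sumw j p : \sum_(i <- p) w j i = \sum_(t <- neighbours p) L j t
    + (consts p)%:Z * (c j - e j * (r j)%:Z) - (slacks j p * d j)%:Z * e j.
  have cons1 (b : bool) (k : nat) (x : int) : (b + k)%N%:Z * x = (if b then x else 0) + k%:Z * x.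
    by case: b; rewrite ?add1n ?add0n ?add0r // -addn1 PoszD; ring.
  elim: p => [|i p IHp]; first by rewrite !big_nil /= !mul0r subr0.
  rewrite big_cons IHp /consts /slacks /= !PoszM !cons1 -/(consts p) -/(slacks j p).
  case: i => [t|[i|]] /=.
  - by rewrite big_cons -/(neighbours p); ring.
  - rewrite -/(neighbours p).
    have -> : (inr (Some i) == inr (Some j) :> item) = (i == j) by [].
    by case: (i == j); ring.
  - by rewrite -/(neighbours p); ring.
pose S : seq item := inr None :: [seq inl t | t <- s] ++
  flatten [seq nseq (q j) (inr (Some j)) | j <- iota 0 J].
have SN : neighbours S = s.
  rewrite /S /neighbours /= pmap_cat.
  have -> : pmap (fun i : item => if i is inl t then Some t else None)
    (flatten [seq nseq (q j) (inr (Some j)) | j <- iota 0 J]) = [::].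
    elim: (iota 0 J) => //= j l IHl; rewrite pmap_cat IHl cats0.
    by elim: (q j).
  by rewrite cats0; elim: (s) => //= t l ->.
have SC : consts S = 1%N.
  rewrite /consts /S /= count_cat count_map count_flatten -map_comp.
  rewrite (@eq_count _ _ pred0) // count_pred0.
  rewrite (@eq_map _ _ _ (fun=> 0%N)) ?add1n; last by move=> j /=; rewrite count_nseq.
  by rewrite sumnE big_map big1.
have SS j : (j < J)%N -> slacks j S = q j.
  move=> jJ; rewrite /slacks /S /= count_cat count_map count_flatten -map_comp.
  rewrite (@eq_count _ _ pred0) // count_pred0 !add0n.
  rewrite (@eq_map _ _ _ (fun i => (i == j) * q i)%N); last first.
    by move=> i /=; rewrite count_nseq.
  rewrite sumnE big_map (bigD1_seq j) ?iota_uniq ?mem_iota //= eqxx mul1n big1 ?addn0 //.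
  by move=> i /negbTE ->.
have [||ss pss hss] := @zero_sum_split _ w J (2 * E) S.
- move=> [t|[i|]] _ j jJ /=.
  + by apply: le_trans (L_le t jJ) _; rewrite lez_nat mul2n -addnn leq_addl.
  + have := d_le jJ; have := e_le j; case: eqP; nia.
  + have := c_le j jJ; have := e_le j; have := r_le j; have := d_le jJ; nia.
- move=> j jJ; rewrite sumw SN SC SS // mul1r.
  have := vE j; rewrite PoszD mulrDr [e j * (q j * d j)%:Z]mulrC; lia.
pose P (k : option T) (p : seq item) : bool := (if k is Some t then inl t else inr None : item) \in p.
have inS x : x \in S -> has (fun p : seq item => x \in p) ss.
  by rewrite -(perm_mem pss) => /flattenP[p]; move=> *; apply/hasP; exists p.
have [|A [B [pAB sA hA]]] := @extract_marked _ _ ss (None :: map Some (undup s)) P.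
  move=> [t|] kin; last by apply: inS; rewrite mem_head.
  apply: inS; rewrite inE /= mem_cat map_f //.
  by move: kin; rewrite inE /= => /mapP[t' ts [->]]; rewrite mem_undup in ts.
have hA' t : t \in s -> (inl t : item) \in flatten A.
  move=> ts; have /hA : Some t \in None :: map Some (undup s).
    by rewrite inE map_f ?orbT // mem_undup.
  by case/hasP => p pA ip; apply/flattenP; exists p.
(* The constant term occurs only once and already lies in [A], so the remaining pieces consist of
   neighbours and slack steps. *)
have A1 : consts (flatten A ++ flatten B) = 1%N.
  by rewrite /consts -flatten_cat (seq.permP (perm_flatten pAB)) (seq.permP pss).
have cA : consts (flatten A) = 1%N.
  have /hasP[p pA ip] := hA None (mem_head _ _).
  have : (0 < consts (flatten A))%N.
    by rewrite -has_count; apply/hasP; exists (inr None) => //; apply/flattenP; exists p.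
  by move: A1; rewrite /consts count_cat; lia.
have cB p : p \in B -> consts p = 0%N.
  move=> pB; move: A1; rewrite /consts count_cat -!/(consts _) cA => -[] h.
  apply/eqP; rewrite -leqn0 -h /consts count_flatten.
  rewrite sumnE big_map (big_rem p) //=; exact: leq_addr.
have in_ss p : p \in A ++ B -> p \in ss by rewrite (perm_mem pAB).
have szss p : p \in ss -> (size (neighbours p) <= zs_bound J (2 * E))%N.
  by case/hss => sp _; apply: leq_trans sp; rewrite size_pmap count_size.
exists (neighbours (flatten A)), (map neighbours B); split.
- rewrite -SN.
  have -> : flatten (map neighbours B) = neighbours (flatten B).
    by elim: (B) => //= b l ->; rewrite /neighbours pmap_cat.
  rewrite /neighbours -pmap_cat; apply: perm_pmap.
  by rewrite -flatten_cat -(permPr pss); apply: perm_flatten.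
- move=> p; rewrite inE => /orP[/eqP->|/mapP[b bB ->]].
    apply: leq_trans (_ : size (flatten A) <= _)%N; first by rewrite size_pmap count_size.
    apply: leq_trans (size_flatten_le (N := zs_bound J (2 * E)) _) _.
      by move=> a aA; have [] := hss a (in_ss a _); rewrite // mem_cat aA.
    rewrite leq_mul2r; apply/orP; right; apply: leq_trans sA _.
    rewrite /= size_map ltnS; by rewrite -(card_uniqP (undup_uniq s)) max_card.
  apply: leq_trans (szss _ (in_ss _ _)) _; first by rewrite mem_cat bB orbT.
  by rewrite /local_bound mulSn leq_addr.
- move=> t /hA' tA; rewrite /neighbours mem_pmap; apply/mapP.
  by exists (inl t).
- move=> j jJ.
  have : \sum_(i <- flatten A) w j i = 0.
    rewrite big_flatten big_seq big1 // => p pA.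
    by have [|_] := hss p (in_ss p _); [rewrite mem_cat pA|apply].
  rewrite sumw cA mul1r.
  set k := slacks _ _ => h.
  have -> : c j + \sum_(t <- neighbours (flatten A)) L j t = e j * (r j + k * d j)%:Z.
    by rewrite PoszD mulrDr [e j * (k * d j)%:Z]mulrC; lia.
  by rewrite sgzM /e sgz_id (gtr0_sgz (_ : 0 < (r j + k * d j)%N%:Z)) ?mulr1.
- move=> _ j /mapP[p pB ->] jJ; exists (slacks j p).
  have [|_ /(_ j jJ)] := hss p (in_ss p _); first by rewrite mem_cat pB orbT.
  by rewrite sumw cB // mul0r addr0 => /subr0_eq.
Qed.

End LocalDecomposition.

Local Close Scope ring_scope.

(** * A bounded balanced subsystem *)

Local Open Scope ring_scope.

Lemma Posz_sum (I : Type) (r : seq I) (P : pred I) (f : I -> nat) :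
  (\sum_(i <- r | P i) f i)%N%:Z = \sum_(i <- r | P i) (f i)%:Z.
Proof. exact: (big_morph Posz PoszD). Qed.

Section BoundedSubsystem.
Variables (M T K : finType) (sw : T -> T) (nb base : M -> seq T)
  (ps : M -> seq (seq T)) (kappa : M -> K) (B : nat).
Hypothesis decomp : forall a, perm_eq (base a ++ flatten (ps a)) (nb a).
Hypothesis size_le : forall a p, p \in base a :: ps a -> (size p <= B)%N.
Hypothesis bal : forall t,
  (\sum_a count_mem t (nb a) = \sum_a count_mem (sw t) (nb a))%N.

(* An item is an element of [M] with its base ([true]) or with one of its periods ([false]). *)
Let item : eqType := (M * bool * seq T)%type.
Let items : seq item :=
  flatten [seq (a, true, base a) :: [seq (a, false, q) | q <- ps a] | a <- enum M].
Let excess (t : T) (p : seq T) : int := (count_mem t p)%:Z - (count_mem (sw t) p)%:Z.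

Lemma excess_le t p : `|excess t p| <= (size p)%:Z.
Proof.
rewrite /excess; have h1 : (count_mem t p <= size p)%N := count_size _ _.
have h2 : (count_mem (sw t) p <= size p)%N := count_size _ _.
by move: (count_mem t p) (count_mem (sw t) p) h1 h2 => x y; lia.
Qed.

Lemma sum_items (phi : seq T -> int) : phi [::] = 0 -> {morph phi : p q / p ++ q >-> p + q} ->
  (forall p q, perm_eq p q -> phi p = phi q) ->
  \sum_(i <- items) phi i.2 = \sum_a phi (nb a).
Proof.
move=> phi0 phiD phiP; rewrite big_flatten big_map big_enum /=.
apply: eq_bigr => a _; rewrite big_cons big_map /= -(phiP _ _ (decomp a)) phiD.
by congr (_ + _); elim: (ps a) => [|p l IHl]; rewrite ?big_nil ?big_cons //= phiD IHl.
Qed.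

Lemma mem_items a b q : (a, b, q) \in items -> if b then q = base a else q \in ps a.
Proof.
case/flattenP => l /mapP[a' _ ->]; rewrite inE => /orP[/eqP[-> -> ->]//|].
by case/mapP => q' qps [-> -> ->].
Qed.

Lemma base_in_items a : (a, true, base a) \in items.
Proof.
apply/flattenP; exists ((a, true, base a) :: [seq (a, false, q) | q <- ps a]).
  by apply/mapP; exists a; rewrite ?mem_enum.
by rewrite mem_head.
Qed.

(** One piece is kept for each inhabited class, namely one containing the base of some element of
    that class. The same piece may serve several classes and then occurs repeatedly, which preserves
    the zero sums. *)
Lemma exists_bounded_balanced_items : exists l : seq item,
  [/\ {subset l <= items}, (size l <= #|K| * zs_bound #|T| B)%N,
      forall t, \sum_(i <- l) excess t i.2 = 0 &
      forall a, exists2 a', kappa a' = kappa a & (a', true, base a') \in l].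
Proof.
(* The coordinates are the types, numbered by [enum_rank] to fit [zero_sum_split]. *)
pose w k (i : item) : int := if insub k is Some o then excess (enum_val (o : 'I_#|T|)) i.2 else 0.
have wE t i : w (enum_rank t) i = excess t i.2 by rewrite /w valK enum_rankK.
have exc0 t : \sum_(i <- items) excess t i.2 = 0.
  rewrite (@sum_items (excess t)).
  - by rewrite sumrB -!Posz_sum bal subrr.
  - by rewrite /excess subrr.
  - by move=> p q; rewrite /excess !count_cat !PoszD opprD addrACA.
  - by move=> p q /seq.permP pq; rewrite /excess !pq.
have [||ss pss hss] := @zero_sum_split _ w #|T| B items.
- move=> [[a b] q] ai k _; rewrite /w; case: insubP => // o _ _ /=.
  apply: le_trans (excess_le _ _) _; rewrite lez_nat.
  by apply: (size_le (a := a)); move/mem_items: ai; case: b => [->|h]; rewrite inE ?eqxx ?h ?orbT.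
- move=> k kT; rewrite -[k]/(val (Ordinal kT)) -(enum_valK (Ordinal kT)).
  by under eq_bigr do rewrite wE.
have /fin_all_exists[pf pfP] : forall k : K, exists p : seq item,
    [/\ {subset p <= items}, (size p <= zs_bound #|T| B)%N,
       forall t, \sum_(i <- p) excess t i.2 = 0 &
       forall a, kappa a = k -> exists2 a', kappa a' = k & (a', true, base a') \in p].
  move=> k; case: (pickP (fun a => kappa a == k)) => [a /eqP ak|nok]; last first.
    by exists [::]; split=> // [t|a /eqP]; rewrite ?big_nil ?nok.
  have := base_in_items a; rewrite -(perm_mem pss) => /flattenP[p pss' ip].
  have [sp zp] := hss p pss'; exists p; split=> //.
  - by move=> i ii; rewrite -(perm_mem pss); apply/flattenP; exists p.
  - by move=> t; rewrite -[RHS](zp (enum_rank t)) //; under [RHS]eq_bigr do rewrite wE.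
  - by move=> _ _; exists a.
exists (flatten [seq pf k | k <- enum K]); split.
- by move=> i /flattenP[p /mapP[k _ ->]]; have [+ _ _ _] := pfP k; apply.
- apply: leq_trans (size_flatten_le (N := zs_bound #|T| B) _) _.
    by move=> p /mapP[k _ ->]; have [] := pfP k.
  by rewrite size_map -cardE.
- move=> t; rewrite big_flatten big_map big1 // => k _.
  by have [_ _ + _] := pfP k; apply.
- move=> a; have [_ _ _ /(_ a erefl)[a' ka' ia']] := pfP (kappa a).
  exists a' => //; apply/flattenP; exists (pf (kappa a)) => //.
  by apply: map_f; rewrite mem_enum.
Qed.

(** The base items of [l] become the vertices. A period in [l] may belong to an element whose base
    is not in [l], so it is handed to a chosen vertex of the same class. *)
Lemma bounded_balanced_system : exists (n : nat) (h : 'I_n -> M) (F : 'I_n -> seq T),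
  [/\ forall t, (\sum_i count_mem t (F i) = \sum_i count_mem (sw t) (F i))%N,
      forall i, exists qs : seq (seq T), F i = base (h i) ++ flatten qs /\
        forall q, q \in qs -> exists2 a, kappa a = kappa (h i) & q \in ps a,
      forall a, exists i, kappa (h i) = kappa a,
      (n <= #|K| * zs_bound #|T| B)%N &
      (\sum_i size (F i) <= #|K| * zs_bound #|T| B * B)%N].
Proof.
have [l [l_sub l_size l_bal l_base]] := exists_bounded_balanced_items.
pose bl := [seq i <- l | i.1.2].
pose h (i : 'I_(size bl)) : M := (tnth (in_tuple bl) i).1.1.
pose host k := [pick i | kappa (h i) == k].
have hostP a : exists2 i, host (kappa a) = Some i & kappa (h i) = kappa a.
  rewrite /host; case: pickP => [i /eqP ki|no]; first by exists i.
  have [a' ka' la'] := l_base a.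
  have : (a', true, base a') \in bl by rewrite mem_filter.
  by case/(@tnthP _ _ (in_tuple bl)) => i iE; have := no i; rewrite /h -iE ka' eqxx.
pose extra i := [seq x.2 | x <- l & ~~ x.1.2 && (host (kappa x.1.1) == Some i)].
pose F i := base (h i) ++ flatten (extra i).
(* Each base item is one vertex and each period has exactly one host, so any additive quantity has
   the same total over vertices as over items. This is applied to the excess of a type and to the
   size. *)
have sumF (phi : seq T -> int) : phi [::] = 0 -> {morph phi : p q / p ++ q >-> p + q} ->
    \sum_i phi (F i) = \sum_(x <- l) phi x.2.
  move=> phi0 phiD.
  have phif ss : phi (flatten ss) = \sum_(p <- ss) phi p.
    by elim: ss => [|p ss IHss]; rewrite ?big_nil ?big_cons //= phiD IHss.
  under eq_bigr => i _ do rewrite phiD phif big_map big_filter.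
  rewrite big_split /= (bigID (fun x : item => x.1.2)) /=; congr (_ + _).
    rewrite -[RHS]big_filter -/bl (big_tnth _ _ bl); apply: eq_bigr => i _.
    rewrite /h; case E: (tnth _ _) => [[a b] q] /=.
    have : (a, b, q) \in bl by rewrite -E mem_tnth.
    by rewrite mem_filter /= => /andP[bT /l_sub /mem_items]; rewrite bT => ->.
  under eq_bigr => i _ do rewrite big_mkcondr.
  rewrite exchange_big /=; apply: eq_bigr => x _; rewrite -big_mkcond /=.
  have [i iE _] := hostP x.1.1.
  by rewrite (big_pred1 i) // => j; rewrite iE /= eq_sym.
exists (size bl), h, F; split.
- move=> t; apply/eqP; rewrite -eqz_nat !Posz_sum -subr_eq0 -sumrB.
  rewrite (sumF (excess t)) ?l_bal // => p q.
  by rewrite /excess !count_cat !PoszD opprD addrACA.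
- move=> i; exists (extra i); split=> // q /mapP[[[a b] q']].
  rewrite mem_filter /= => /andP[/andP[/negbTE-> /eqP hE] /l_sub/mem_items qps] ->.
  exists a => //; have [i' + <-] := hostP a.
  by rewrite hE => -[->].
- by move=> a; have [i _ iE] := hostP a; exists i.
- by apply: leq_trans l_size; rewrite size_filter count_size.
- rewrite -lez_nat Posz_sum (sumF (fun p => (size p)%:Z)) //; last first.
    by move=> p q; rewrite size_cat PoszD.
  rewrite -Posz_sum lez_nat; apply: leq_trans (_ : size l * B <= _)%N; last first.
    by rewrite leq_mul2r l_size orbT.
  elim: (l) l_sub => [|x l' IHl] l_sub; rewrite ?big_nil // big_cons /= mulSn leq_add //.
    have := l_sub x (mem_head _ _); case: x {l_sub} => [[a b] q] /mem_items qE.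
    by apply: (size_le (a := a)); case: b qE => [->|h']; rewrite inE ?eqxx ?h' ?orbT.
  by apply: IHl => y yl; apply: l_sub; rewrite inE yl orbT.
Qed.

End BoundedSubsystem.

Local Close Scope ring_scope.

(** * Types and truth transfer *)

Scheme fml_mutind := Induction for fml Sort Prop
  with sterm_mutind := Induction for sterm Sort Prop.
Combined Scheme fml_sterm_ind from fml_mutind, sterm_mutind.

Lemma veqP v w : reflect (v = w) (veq v w).
Proof. by case: v; case: w; constructor. Qed.

Lemma veqxx v : veq v v. Proof. by case: v. Qed.

Definition asg (A : Type) (v : var) (a b : A) : var -> A := fun w => if veq w v then a else b.

Definition term_guard (v : var) (R : nat) (rev : bool) : atom :=
  if rev then ABin R (other v) v else ABin R v (other v).

(** Guards are listed as atoms of their own, including those hidden in Presburger terms: types have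
    to decide them, and binary atoms of the list define the edges. *)
Fixpoint subfmls (f : fml) : seq fml :=
  f :: match f with
       | FAtom _ | FEq _ _ => [::]
       | FNeg g => subfmls g
       | FAnd g h | FOr g h => subfmls g ++ subfmls h
       | FEx _ _ a g | FAll _ _ a g => FAtom a :: subfmls g
       | FPres v ts _ _ => term_subfmls v ts
       end
with term_subfmls (v : var) (ts : sterm) : seq fml :=
  match ts with
  | SNil => [::]
  | SCons _ R rev g r => FAtom (term_guard v R rev) :: subfmls g ++ term_subfmls v r
  end.

Lemma In_cat (A : Type) (x : A) (s t : seq A) : List.In x (s ++ t) <-> List.In x s \/ List.In x t.
Proof. by elim: s => /= [|y s ->]; [split=> [|[]]; auto | rewrite or_assoc]. Qed.

Lemma In_subfmls f : List.In f (subfmls f).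
Proof. by case: f => *; left. Qed.

(** * Dependence of truth on the free variables *)

Section Locality.
Variables (M : finType) (U : nat -> M -> bool) (B : nat -> M -> M -> bool).

Lemma asat_fv a (s s' : var -> M) : (forall v, avars a v -> s v = s' v) -> asat U B a s = asat U B a s'.
Proof. by case: a => [P v|R v w] /= h; rewrite !h // veqxx ?orbT. Qed.

(** A term sum sees only its free variable, since the counted one is overwritten in every count. *)
Lemma sat_tsum_fv :
  (forall f (s s' : var -> M), (forall v, fv f v -> s v = s' v) -> sat U B f s = sat U B f s') /\
  (forall ts v (s s' : var -> M), s v = s' v -> tsum U B v ts s = tsum U B v ts s').
Proof.
have qE qx qy a g (s s' : var -> M) :
    (forall v, ~~ quant qx qy v && (avars a v || fv g v) -> s v = s' v) ->
    forall u w v, avars a v || fv g v -> qupd qx qy s u w v = qupd qx qy s' u w v.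
  move=> h u w [] /= hv; [case: qx h => // h; exact: (h vx hv)|case: qy h => // h; exact: (h vy hv)].
apply: fml_sterm_ind.
- by move=> a s s' h /=; apply: asat_fv.
- by move=> v w s s' /= h; rewrite !h // veqxx ?orbT.
- by move=> g IH s s' /= h; rewrite (IH _ s').
- by move=> g IHg h IHh s s' /= e; rewrite (IHg _ s') 1?(IHh _ s') // => v hv; apply: e; rewrite hv ?orbT.
- by move=> g IHg h IHh s s' /= e; rewrite (IHg _ s') 1?(IHh _ s') // => v hv; apply: e; rewrite hv ?orbT.
- move=> qx qy a g IH s s' /= /qE h.
  apply: eq_existsb => u; apply: eq_existsb => w.
  by rewrite (asat_fv (s' := qupd qx qy s' u w)) 1?(IH _ (qupd qx qy s' u w)) // => v hv; apply: h; rewrite hv ?orbT.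
- move=> qx qy a g IH s s' /= /qE h.
  apply: eq_forallb => u; apply: eq_forallb => w.
  by rewrite (asat_fv (s' := qupd qx qy s' u w)) 1?(IH _ (qupd qx qy s' u w)) // => v hv; apply: h; rewrite hv ?orbT.
- by move=> v ts IH c d s s' /= h; rewrite (IH _ _ s') // h ?veqxx.
- by [].
- move=> lam R rev g IHg r IHr v s s' /= e; rewrite (IHr _ _ s') //; congr (_ * _%:Z + _)%R.
  apply: eq_card => b; rewrite !inE e (IHg _ (upd s' (other v) b)) // => w _.
  by rewrite /upd; case: veqP => // n; case: v w n e => [] [] //= [].
Qed.

Lemma sat_fv f (s s' : var -> M) : (forall v, fv f v -> s v = s' v) -> sat U B f s = sat U B f s'.
Proof. by move=> h; apply: sat_tsum_fv.1. Qed.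

Lemma sat_ext f (s s' : var -> M) : s =1 s' -> sat U B f s = sat U B f s'.
Proof. by move=> e; apply: sat_fv => v _. Qed.

Lemma satExP qx qy a g (s : var -> M) :
  reflect (exists s', [/\ forall v, ~~ quant qx qy v -> s' v = s v, asat U B a s' & sat U B g s'])
    (sat U B (FEx qx qy a g) s).
Proof.
apply: (iffP existsP) => [[u /existsP[w /andP[ha hg]]]|[s' [e ha hg]]].
  exists (qupd qx qy s u w); split=> // -[] /= /negbTE -> //.
exists (s' vx); apply/existsP; exists (s' vy).
have E : qupd qx qy s (s' vx) (s' vy) =1 s'.
  move=> [] /=; [case: qx e => // e|case: qy e => // e]; rewrite e //.
apply/andP; split; first by rewrite (asat_fv (s' := s')).
by have := hg; rewrite -(sat_ext _ E).
Qed.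

Lemma satAll qx qy a g (s : var -> M) :
  sat U B (FAll qx qy a g) s = ~~ sat U B (FEx qx qy a (FNeg g)) s.
Proof.
rewrite /= negb_exists; apply: eq_forallb => u; rewrite negb_exists; apply: eq_forallb => w.
by rewrite negb_and negbK implybE.
Qed.

End Locality.

(** Applied to both structures, with [edge_type] in the old one and [lab] in the new one. The point
    [u] is counted apart because a guard may hold at the pair of [u] with itself, which carries no
    label. *)
Lemma card_labelled (T V : finType) (lab : V -> option T) (F : seq T) (u : V)
    (Q : pred V) (b : T -> bool) :
  lab u = None -> (forall t, #|[pred w | lab w == Some t]| = count_mem t F) ->
  (forall w t, lab w = Some t -> Q w = b t) ->
  (forall w, w != u -> lab w = None -> Q w = false) ->
  #|Q| = Q u + \sum_(t <- F) b t.
Proof.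
move=> labu cnt QS QN.
rewrite -sum1_card big_mkcond (bigD1 u) //=; congr (_ + _).
transitivity (\sum_w \sum_t (lab w == Some t) * b t).
  rewrite [RHS](bigD1 u) //= [X in _ = X + _]big1 ?add0n; last by move=> t _; rewrite labu.
  apply: eq_bigr => w wu; rewrite /in_mem /=.
  case E: (lab w) => [t|]; last by rewrite QN // big1.
  rewrite (QS _ _ E) (bigD1 t) //= eqxx mul1n big1 ?addn0 //.
  by move=> t' /negbTE tt'; rewrite (inj_eq Some_inj) eq_sym tt'.
rewrite exchange_big /=.
transitivity (\sum_t \sum_(t' <- F) (t' == t) * b t).
  apply: eq_bigr => t _; rewrite -!big_distrl /=; congr (_ * _).
  transitivity #|[pred w | lab w == Some t]|.
    by rewrite -sum1_card [RHS]big_mkcond.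
  by rewrite cnt -sum1_count big_mkcond.
rewrite exchange_big /=; apply: eq_bigr => t' _.
rewrite (bigD1 t') //= eqxx mul1n big1 ?addn0 // => t /negbTE tt'.
by rewrite eq_sym tt'.
Qed.

(** * Two-types and the multiset of types around an element *)

Section Types.
Variables (M : finType) (U : nat -> M -> bool) (B : nat -> M -> M -> bool) (cl : seq fml).

Definition truths (s : var -> M) : (size cl).-tuple bool :=
  map_tuple (fun g => sat U B g s) (in_tuple cl).

(* Truth vectors of [(a, b)], [(b, a)], [(a, a)] and [(b, b)], where [(a, b)] stands for x := a, y := b. *)
Definition ttype : finType :=
  (((size cl).-tuple bool * (size cl).-tuple bool) * ((size cl).-tuple bool * (size cl).-tuple bool))%type.

Definition pair_type (a b : M) : ttype :=
  ((truths (asg vx a b), truths (asg vy a b)), (truths (asg vx a a), truths (asg vx b b))).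

Definition conv_type (t : ttype) : ttype := ((t.1.2, t.1.1), (t.2.2, t.2.1)).

Lemma conv_typeK : involutive conv_type. Proof. by move=> [[a b] [c d]]. Qed.

Lemma truths_sat s s' g : truths s = truths s' -> List.In g cl -> sat U B g s = sat U B g s'.
Proof.
move=> /(congr1 val) /=; elim: cl => //= h l IHl [e /IHl{}IHl] [<-|/IHl] //.
Qed.

Lemma truths_ext s s' : s =1 s' -> truths s = truths s'.
Proof.
by move=> e; apply: val_inj => /=; apply: eq_map => g; apply: sat_ext.
Qed.

Lemma asgC (A : Type) v (a b : A) : asg (other v) a b =1 asg v b a.
Proof. by case: v => -[]. Qed.

Lemma asgxx (A : Type) v (a : A) : asg v a a =1 fun=> a.
Proof. by move=> w; rewrite /asg; case: ifP. Qed.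

Lemma pair_typeC a b : pair_type b a = conv_type (pair_type a b).
Proof.
by rewrite /pair_type /conv_type /=; congr ((_, _), (_, _)); apply: truths_ext; [exact: (asgC vy)|exact: (asgC vx)].
Qed.

Lemma pair_type_truths a b a' b' v : pair_type a b = pair_type a' b' -> truths (asg v a b) = truths (asg v a' b').
Proof. by rewrite /pair_type => -[e1 e2 _ _]; apply: val_inj; case: v. Qed.

Lemma pair_type_truths1 a b a' b' : pair_type a b = pair_type a' b' -> truths (fun=> a) = truths (fun=> a').
Proof.
rewrite /pair_type => -[_ _ e _]; rewrite -(truths_ext (asgxx vx a)) -(truths_ext (asgxx vx a')).
exact: val_inj.
Qed.

Definition is_bin (g : fml) : bool := if g is FAtom (ABin _ _ _) then true else false.

(** Contains all pairs of distinct elements linked by a binary atom of [cl]. A loop atom true at an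
    endpoint may create further edges; these are harmless, since they have a type like the
    others. *)
Definition edge (a b : M) : bool := (a != b) &&
  has (fun g => is_bin g && (sat U B g (asg vx a b) || sat U B g (asg vy a b))) cl.

Lemma edgeC a b : edge a b = edge b a.
Proof.
rewrite /edge eq_sym; congr (_ && _); apply: eq_has => g; rewrite orbC.
by rewrite (sat_ext U B g (asgC vx a b)) (sat_ext U B g (asgC vy a b)).
Qed.

Lemma edge_atom R v w z a b : List.In (FAtom (ABin R v w)) cl -> v <> w ->
  sat U B (FAtom (ABin R v w)) (asg z a b) -> a != b -> edge a b.
Proof.
move=> inc _ h ab; rewrite /edge ab /=.
elim: cl inc => //= g l IHl [->|/IHl ->]; last by rewrite orbT.
by case: z h => /= ->; rewrite ?orbT.
Qed.

Definition edge_type (a b : M) : option ttype := if edge a b then Some (pair_type a b) else None.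

Definition nb_types (a : M) : seq ttype := pmap (edge_type a) (enum M).

Lemma count_nb_types a t : count_mem t (nb_types a) = #|[pred b | edge_type a b == Some t]|.
Proof.
rewrite /nb_types cardE /enum_mem size_filter -enumT /=.
elim: (enum M) => //= b l IHl; rewrite -IHl.
by case E: (edge_type a b) => [t'|] /=; rewrite inE E.
Qed.

Lemma nb_typesP a t : reflect (exists2 b, edge a b & pair_type a b = t) (t \in nb_types a).
Proof.
rewrite /nb_types mem_pmap; apply: (iffP mapP) => [[b _]|[b e <-]].
  by rewrite /edge_type; case: ifP => // e [->]; exists b.
by exists b; rewrite ?mem_enum // /edge_type e.
Qed.

Variable m0 : M.

(** A witness pair for each type of an edge. Formulas at a label can thus be evaluated in [M]. *)
Definition type_repr (t : ttype) : M * M :=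
  odflt (m0, m0) [pick p | edge p.1 p.2 && (pair_type p.1 p.2 == t)].

Lemma type_reprP a b : edge a b -> edge (type_repr (pair_type a b)).1 (type_repr (pair_type a b)).2 /\
   pair_type (type_repr (pair_type a b)).1 (type_repr (pair_type a b)).2 = pair_type a b.
Proof.
rewrite /type_repr => e; case: pickP => [p /andP[ep /eqP]|/(_ (a, b))] //=.
by rewrite e eqxx.
Qed.

Definition body (v : var) (R : nat) (rev : bool) (g : fml) : fml :=
  FAnd (FAtom (term_guard v R rev)) g.

(** The element may count itself. This gives the constant term of the linear condition, while
    [type_weight] gives the coefficient of each neighbour type. *)
Fixpoint self_weight (v : var) (ts : sterm) (a : M) : int :=
  match ts with
  | SNil => 0
  | SCons lam R rev g r =>
      (lam * (sat U B (body v R rev g) (fun=> a) : nat)%:Z + self_weight v r a)%R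
  end.

Fixpoint type_weight (v : var) (ts : sterm) (t : ttype) : int :=
  match ts with
  | SNil => 0
  | SCons lam R rev g r =>
      (lam * (sat U B (body v R rev g) (asg v (type_repr t).1 (type_repr t).2) : nat)%:Z + type_weight v r t)%R
  end.

End Types.

(** * Transfer of truth to a labelled structure *)

Section Truth.
Variables (M : finType) (U : nat -> M -> bool) (B : nat -> M -> M -> bool) (cl : seq fml) (m0 : M).
Local Notation T := (ttype cl).
Local Notation pair_type := (pair_type U B cl).
Local Notation truths := (truths U B cl).
Local Notation type_repr := (type_repr U B m0).
Local Notation nb_types := (nb_types U B cl).
Local Notation edge := (edge U B cl).
Variables (V : finType) (hm : V -> M) (lab : V -> V -> option T) (F : V -> seq T).
Hypothesis lab_sw : forall u w, lab w u = omap (@conv_type cl) (lab u w).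
Hypothesis lab_irr : forall u, lab u u = None.
Hypothesis lab_count : forall u t, #|[pred w | lab u w == Some t]| = count_mem t (F u).
Hypothesis F_supp : forall u, F u =i nb_types (hm u).
Hypothesis hm_surj : forall a, exists u, pair_type (hm u) (hm u) = pair_type a a /\ nb_types (hm u) =i nb_types a.
Hypothesis F_pres : forall u v ts c d, List.In (FPres v ts c d) cl ->
  cmp_holds c (self_weight U B v ts (hm u) + \sum_(t <- F u) type_weight U B m0 v ts t)%R d =
  cmp_holds c (self_weight U B v ts (hm u) + \sum_(t <- nb_types (hm u)) type_weight U B m0 v ts t)%R d.

Definition UN (P : nat) (u : V) : bool := U P (hm u).
Definition BN (R : nat) (u w : V) : bool :=
  if u == w then B R (hm u) (hm u)
  else if lab u w is Some t then B R (type_repr t).1 (type_repr t).2 else false.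

Lemma labP u w t : lab u w = Some t -> exists2 b, edge (hm u) b & pair_type (hm u) b = t.
Proof.
move=> e; apply/nb_typesP; rewrite -F_supp -has_pred1 has_count -lab_count.
by apply/card_gt0P; exists w; rewrite inE e.
Qed.

Lemma lab_type_repr u w t : lab u w = Some t ->
  edge (type_repr t).1 (type_repr t).2 /\ pair_type (type_repr t).1 (type_repr t).2 = t.
Proof. by case/labP => b eb <-; apply: type_reprP. Qed.

Lemma lab_truths1 u w t : lab u w = Some t -> truths (fun=> hm u) = truths (fun=> (type_repr t).1).
Proof.
move=> e; have [_ rE] := lab_type_repr e; have [b _ bE] := labP e.
by apply: (@pair_type_truths1 _ _ _ _ _ b _ (type_repr t).2); rewrite rE bE.
Qed.

Lemma lab_truths2 u w t : lab u w = Some t -> truths (fun=> hm w) = truths (fun=> (type_repr t).2).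
Proof.
move=> e; have [_ rE] := lab_type_repr e.
have e' : lab w u = Some (conv_type t) by rewrite lab_sw e.
have [b _ bE] := labP e'.
by apply: (@pair_type_truths1 _ _ _ _ _ b _ (type_repr t).1); rewrite bE [RHS]pair_typeC rE.
Qed.

Lemma lab_neq u w t : lab u w = Some t -> u != w.
Proof. by case: eqP => // ->; rewrite lab_irr. Qed.

(** Members of [cl] have this property; it is stated separately because it is also required of a
    guard conjoined with its formula and of negations, which may lie outside [cl]. *)
Definition type_inv (g : fml) := forall s s', truths s = truths s' -> sat U B g s = sat U B g s'.

(** The induction invariant. Distinct pairs without a label are left out: the formulas [g] below a
    quantifier are evaluated only under a guard. *)
Definition truth (g : fml) :=
  (forall u, sat UN BN g (fun=> u) = sat U B g (fun=> hm u)) /\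
  (forall v u w t, lab u w = Some t ->
     sat UN BN g (asg v u w) = sat U B g (asg v (type_repr t).1 (type_repr t).2)).

Lemma type_inv_cl g : List.In g cl -> type_inv g.
Proof. by move=> gcl s s' e; apply: truths_sat gcl. Qed.

Lemma sat_local (K : finType) (UK : nat -> K -> bool) BK g z (s : var -> K) :
  (forall z', fv g z' -> z' = z) -> sat UK BK g s = sat UK BK g (fun=> s z).
Proof. by move=> h; apply: sat_fv => v /h ->. Qed.

(** With at most one free variable single points suffice, because a label fixes the truth vectors of
    both its endpoints. *)
Lemma truth_local g z : type_inv g -> (forall z', fv g z' -> z' = z) ->
  (forall u, sat UN BN g (fun=> u) = sat U B g (fun=> hm u)) -> truth g.
Proof.
move=> ig loc h; split=> // v u w t e.
rewrite (sat_local _ _ _ loc) [RHS](sat_local _ _ _ loc) h /asg.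
by case: (veq z v); apply: ig; [apply: lab_truths1 e|apply: lab_truths2 e].
Qed.

Lemma truth_atom a : List.In (FAtom a) cl -> truth (FAtom a).
Proof.
move=> acl; have ia := type_inv_cl acl; case: a acl ia => [P z|R z1 z2] acl ia.
  by apply: (truth_local (z := z)) => // z' /veqP.
have cst u : sat UN BN (FAtom (ABin R z1 z2)) (fun=> u) = sat U B (FAtom (ABin R z1 z2)) (fun=> hm u).
  by rewrite /= /BN eqxx.
case: (veqP z1 z2) => [e|ne].
  by apply: (truth_local (z := z1)) => // z' /=; rewrite e orbb => /veqP.
split=> // v u w t e /=; have e' : lab w u = Some (conv_type t) by rewrite lab_sw e.
have [_ rE] := lab_type_repr e; have [_ rE'] := lab_type_repr e'.
case: (veqP z1 v) => e1.
  have -> : z2 = other v by move: ne; rewrite e1; case: (z2); case: (v).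
  have asg1 (A : Type) (a b : A) : asg v a b v = a by rewrite /asg veqxx.
  have asg2 (A : Type) (a b : A) : asg v a b (other v) = b by rewrite /asg; case: (v).
  by rewrite e1 !asg1 !asg2 /BN (negbTE (lab_neq e)) e.
have z1E : z1 = other v by move: e1; case: (z1); case: (v).
have z2E : z2 = v by move: ne e1; case: (z1); case: (z2); case: (v).
have asg1 (A : Type) (a b : A) : asg v a b v = a by rewrite /asg veqxx.
have asg2 (A : Type) (a b : A) : asg v a b (other v) = b by rewrite /asg; case: (v).
rewrite z1E z2E !asg1 !asg2 /BN (negbTE (lab_neq e')) e'.
(* The representative of the converse type need not be the swapped representative of [t]; the two
   pairs only agree on [cl], which suffices for this atom. *)
have := ia (asg v (type_repr (conv_type t)).2 (type_repr (conv_type t)).1) (asg v (type_repr t).1 (type_repr t).2).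
rewrite /= z1E z2E !asg1 !asg2; apply; apply: pair_type_truths.
by apply: etrans (pair_typeC _ _ _ _ _) _; apply: etrans (congr1 (@conv_type cl) rE') _; rewrite conv_typeK -[LHS]rE.
Qed.

Lemma truth_eq z1 z2 : truth (FEq z1 z2).
Proof.
split=> [u|v u w t e] /=; first by rewrite !eqxx.
have [/andP[ne _] _] := lab_type_repr e; have ne' := lab_neq e.
rewrite /asg; case: (veq z1 v); case: (veq z2 v); rewrite ?eqxx //.
  by rewrite (negbTE ne) (negbTE ne').
by rewrite eq_sym (negbTE ne') eq_sym (negbTE ne).
Qed.

Lemma truth_and g h : truth g -> truth h -> truth (FAnd g h).
Proof.
by move=> [g1 g2] [h1 h2]; split=> [u|v u w t e] /=; rewrite ?g1 ?h1 // (g2 _ _ _ _ e) (h2 _ _ _ _ e).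
Qed.

Lemma truth_or g h : truth g -> truth h -> truth (FOr g h).
Proof.
by move=> [g1 g2] [h1 h2]; split=> [u|v u w t e] /=; rewrite ?g1 ?h1 // (g2 _ _ _ _ e) (h2 _ _ _ _ e).
Qed.

Lemma truth_neg g : truth g -> truth (FNeg g).
Proof.
by move=> [g1 g2]; split=> [u|v u w t e] /=; rewrite ?g1 // (g2 _ _ _ _ e).
Qed.

Lemma type_inv_and g h : type_inv g -> type_inv h -> type_inv (FAnd g h).
Proof. by move=> ig ih s s' e /=; rewrite (ig _ _ e) (ih _ _ e). Qed.

Lemma card_F u (Q : pred V) (b : T -> bool) :
  (forall w t, lab u w = Some t -> Q w = b t) ->
  (forall w, w != u -> lab u w = None -> Q w = false) ->
  #|Q| = Q u + \sum_(t <- F u) b t.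
Proof. exact: card_labelled (lab_irr u) (lab_count u). Qed.

Lemma card_nb_types a (Q : pred M) (b : T -> bool) :
  (forall w t, edge_type U B cl a w = Some t -> Q w = b t) ->
  (forall w, w != a -> edge_type U B cl a w = None -> Q w = false) ->
  #|Q| = Q a + \sum_(t <- nb_types a) b t.
Proof.
apply: card_labelled; first by rewrite /edge_type /edge eqxx.
by move=> t; rewrite count_nb_types.
Qed.

Lemma sat_term_guard (K : finType) (UK : nat -> K -> bool) BK v R i (a b : K) :
  sat UK BK (FAtom (term_guard v R i)) (asg v a b) = if i then BK R b a else BK R a b.
Proof. by rewrite /term_guard; case: i; case: v. Qed.

Lemma card_term (K : finType) (UK : nat -> K -> bool) BK v R i g (a : K) :
  #|[pred b : K | (if i then BK R b a else BK R a b) && sat UK BK g (upd (fun=> a) (other v) b)]| =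
  #|[pred b : K | sat UK BK (body v R i g) (asg v a b)]|.
Proof.
apply: eq_card => b; rewrite !inE.
rewrite -[RHS]/(sat UK BK (FAtom (term_guard v R i)) (asg v a b) && sat UK BK g (asg v a b)) sat_term_guard.
by congr (_ && _); apply: sat_ext => w; rewrite /upd /asg; case: v; case: w.
Qed.

Lemma tsum_nb_types v ts : (forall h, List.In h (term_subfmls v ts) -> List.In h cl) ->
  forall a, tsum U B v ts (fun=> a) =
    (self_weight U B v ts a + \sum_(t <- nb_types a) type_weight U B m0 v ts t)%R.
Proof.
elim: ts => [|lam R i g r IHr] incl a /=; first by rewrite big1.
have acl : List.In (FAtom (term_guard v R i)) cl by apply: incl; left.
have gcl : List.In g cl by apply: incl; right; rewrite In_cat; left; apply: In_subfmls.
rewrite IHr; last by move=> h hr; apply: incl; right; rewrite In_cat; right.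
rewrite card_term (@card_nb_types a _ (fun t => sat U B (body v R i g) (asg v (type_repr t).1 (type_repr t).2))).
- rewrite -[X in (X + _)%N]/(sat U B (body v R i g) (asg v a a) : nat).
  rewrite (sat_ext _ _ _ (asgxx v a)) PoszD Posz_sum mulrDr big_split /= -mulr_sumr.
  ring.
- move=> b t; rewrite /edge_type; case: ifP => // eab [<-].
  have [_ rE] := type_reprP m0 eab.
  by apply: type_inv_and; [apply: type_inv_cl acl|apply: type_inv_cl gcl|apply: pair_type_truths; rewrite rE].
- move=> b ba; rewrite /edge_type; case: ifP => // /negbT ne _.
  rewrite -[LHS]/(sat U B (FAtom (term_guard v R i)) (asg v a b) && sat U B g (asg v a b)).
  apply/negbTE; apply: contra ne => /andP[h _]; rewrite eq_sym in ba.
  move: acl h; rewrite /term_guard.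
  by case: (i) => acl h; apply: edge_atom acl _ h ba; case: (v).
Qed.

(** Same constant and coefficients as in [tsum_nb_types]; only the multiset of types differs, and
    this difference is what [F_pres] controls. *)
Lemma tsum_F v ts : (forall h, List.In h (term_subfmls v ts) -> List.In h cl) ->
  (forall h, List.In h (term_subfmls v ts) -> truth h) ->
  forall u, tsum UN BN v ts (fun=> u) =
    (self_weight U B v ts (hm u) + \sum_(t <- F u) type_weight U B m0 v ts t)%R.
Proof.
elim: ts => [|lam R i g r IHr] incl tr u /=; first by rewrite big1.
have ta := tr (FAtom (term_guard v R i)) (or_introl erefl).
have tg : truth g by apply: tr; right; rewrite In_cat; left; apply: In_subfmls.
rewrite IHr; last 2 first.
- by move=> h hr; apply: incl; right; rewrite In_cat; right.
- by move=> h hr; apply: tr; right; rewrite In_cat; right.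
have [tb1 tb2] : truth (body v R i g) by apply: truth_and.
rewrite card_term (@card_F u _ (fun t => sat U B (body v R i g) (asg v (type_repr t).1 (type_repr t).2))).
- rewrite -[X in (X + _)%N]/(sat UN BN (body v R i g) (asg v u u) : nat).
  rewrite (sat_ext _ _ _ (asgxx v u)) tb1 PoszD Posz_sum mulrDr big_split /= -mulr_sumr.
  ring.
- by move=> w t e; rewrite -[LHS]/(sat UN BN (body v R i g) (asg v u w)) (tb2 _ _ _ _ e).
- move=> w wu e.
  rewrite -[LHS]/(sat UN BN (FAtom (term_guard v R i)) (asg v u w) && sat UN BN g (asg v u w)).
  rewrite sat_term_guard /BN (negbTE wu) eq_sym (negbTE wu) e.
  have -> : lab w u = None by rewrite lab_sw e.
  by case: (i).
Qed.

Lemma truth_pres v ts c d : List.In (FPres v ts c d) cl ->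
  (forall h, List.In h (term_subfmls v ts) -> List.In h cl) ->
  (forall h, List.In h (term_subfmls v ts) -> truth h) -> truth (FPres v ts c d).
Proof.
move=> pcl incl tr; apply: (truth_local (z := v)); first exact: type_inv_cl.
  by move=> z /veqP.
by move=> u /=; rewrite tsum_nb_types // tsum_F // F_pres.
Qed.

Lemma guard_N R v w u u' z : v <> w -> u != u' ->
  sat UN BN (FAtom (ABin R v w)) (asg z u u') -> exists t, lab u u' = Some t.
Proof.
move=> vw uu'; rewrite /= /BN /asg.
have h (b b' : bool) : b != b' -> (forall x y : V, x != y -> BN R x y -> exists t, lab x y = Some t) ->
  BN R (if b then u else u') (if b' then u else u') -> exists t, lab u u' = Some t.
  case: b; case: b' => // _ H; first by apply: H.
  rewrite eq_sym in uu'; case/(H _ _ uu') => t e; exists (conv_type t).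
  by rewrite lab_sw e.
apply: h; first by move: vw; case: v; case: w; case: z.
move=> x y xy; rewrite /BN (negbTE xy); case: (lab x y) => // t _; by exists t.
Qed.

(** A witness is either a diagonal pair or, if the guard mentions both variables, an edge. Going
    down, [labP] turns a label at [u] into a real neighbour of [hm u]; going up, [F_supp] turns a
    neighbour type into a labelled pair. *)
Lemma truth_ex qx qy a g (f := FEx qx qy a g) :
  List.In (FAtom a) cl -> type_inv g -> truth g -> (forall z, fv g z -> avars a z) -> type_inv f -> truth f.
Proof.
move=> acl ig tg fvg invf.
have ta := truth_atom acl; have ia := type_inv_cl acl.
pose b := FAnd (FAtom a) g.
have [tb1 tb2] : truth b by apply: truth_and.
have ib : type_inv b by apply: type_inv_and.
have satP (K : finType) (UK : nat -> K -> bool) BK (s : var -> K) :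
    reflect (exists2 s', forall v, ~~ quant qx qy v -> s' v = s v & sat UK BK b s') (sat UK BK f s).
  apply: (iffP (satExP _ _ _ _ _ _ _)) => [[s' [h1 h2 h3]]|[s' h1 /andP[h2 h3]]]; exists s' => //.
  exact/andP.
have fvb z : fv b z = avars a z by rewrite /=; case: (boolP (fv g z)) => [/fvg ->|]; rewrite ?orbF ?orbT.
(* A quantified variable may move to any [u] resembling [a0]; a free one has to stay at [u0]. *)
have pick_u z a0 u0 : (~~ quant qx qy z -> a0 = hm u0) ->
    exists u, [/\ ~~ quant qx qy z -> u = u0, truths (fun=> hm u) = truths (fun=> a0) & nb_types (hm u) =i nb_types a0].
  case: (quant qx qy z) => [_|/(_ isT) ->]; last by exists u0.
  by have [u [uE nE]] := hm_surj a0; exists u; split=> //; apply: pair_type_truths1 uE.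
case: (boolP (quant qx qy vx || quant qx qy vy)) => [q|nq]; last first.
  have noq z : ~~ quant qx qy z by move: nq; rewrite negb_or => /andP[]; case: z.
  have fE (K : finType) (UK : nat -> K -> bool) BK (s : var -> K) : sat UK BK f s = sat UK BK b s.
    apply/satP/idP => [[s' h]|h]; last by exists s.
    by rewrite (sat_ext _ _ _ (fun z => h z (noq z))).
  by split=> [u|v u w t e]; rewrite !fE ?tb1 // (tb2 _ _ _ _ e).
have asgE z (K : finType) (s : var -> K) : s =1 asg z (s z) (s (other z)).
  by case: z => -[].
have asg1 z (A : Type) (a1 a2 : A) : asg z a1 a2 z = a1 by rewrite /asg veqxx.
have asg2 z (A : Type) (a1 a2 : A) : asg z a1 a2 (other z) = a2 by case: z.
have [[z1 [z2 [R [aE zne]]]]|[z az]] : (exists z1 z2 R, a = ABin R z1 z2 /\ z1 <> z2) \/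
    (exists z, forall z', avars a z' -> z' = z).
- case: (a) => [P z|R z1 z2]; first by right; exists z => z' /veqP.
  case: (veqP z1 z2) => e; last by left; exists z1, z2, R.
  by right; exists z1 => z'; rewrite /= e orbb => /veqP.
(* [z] is the variable that may remain free; when both are quantified, either choice will do. *)
- have [z zq] : exists z, quant qx qy (other z).
    by case/orP: q => q; [exists vy|exists vx].
  have nz z' : ~~ quant qx qy z' -> z' = z by move: zq; case: z; case: z' => //= ->.
  apply: (truth_local (z := z)) => // [z' /andP[/nz]//|u0].
  apply/satP/satP => -[s' s'E bs'].
  + have [eq|ne] := eqVneq (s' z) (s' (other z)).
      exists (fun=> hm (s' z)) => [v|].
        by move=> qv; rewrite -(nz v qv) s'E.
      rewrite -tb1; rewrite (sat_ext _ _ _ (asgE z _ s')) -eq in bs'.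
      by rewrite -(sat_ext _ _ _ (asgxx z _)).
    move: bs'; rewrite (sat_ext _ _ _ (asgE z _ s')) => bs'.
    have [ab _] := andP bs'; rewrite aE in ab.
    have [t e] := guard_N zne ne ab; have [b' eb' tE] := labP e.
    exists (asg z (hm (s' z)) b') => [v qv|]; first by rewrite (nz v qv) asg1 -(nz v qv) s'E.
    move: bs'; rewrite (tb2 _ _ _ _ e); have [_ rE] := lab_type_repr e.
    by rewrite (ib (asg z (type_repr t).1 (type_repr t).2) (asg z (hm (s' z)) b')) //; apply: pair_type_truths; rewrite rE.
  + have [u [uE tE nE]] := pick_u z (s' z) u0 (s'E z).
    have [eq|ne] := eqVneq (s' z) (s' (other z)).
      exists (fun=> u) => [v qv|]; first by rewrite uE // -(nz v qv).
      rewrite tb1 (ib _ _ tE); rewrite (sat_ext _ _ _ (asgE z _ s')) -eq in bs'.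
      by rewrite -(sat_ext _ _ _ (asgxx z _)).
    move: bs'; rewrite (sat_ext _ _ _ (asgE z _ s')) => bs'.
    have [ab _] := andP bs'; rewrite aE in ab acl.
    have eb := edge_atom acl zne ab ne.
    have tin : pair_type (s' z) (s' (other z)) \in F u.
      by rewrite F_supp nE; apply/nb_typesP; exists (s' (other z)).
    have [w] : exists w, lab u w == Some (pair_type (s' z) (s' (other z))).
      by move: tin; rewrite -has_pred1 has_count -lab_count => /card_gt0P[w]; exists w.
    move/eqP => e; exists (asg z u w) => [v qv|]; first by rewrite (nz v qv) asg1 uE // -(nz v qv).
    rewrite (tb2 _ _ _ _ e); have [_ rE] := type_reprP m0 eb.
    by rewrite (ib _ _ (pair_type_truths z rE)).
(* The guard mentions only [z], so the value of the other variable does not affect the body. *)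
- have bz z' : fv b z' -> z' = z by rewrite fvb; apply: az.
  apply: (truth_local (z := z)) => // [z' /andP[_ /orP[/az//|/fvg/az//]]|u0].
  apply/satP/satP => -[s' s'E bs']; rewrite (sat_local _ _ _ bz) in bs'.
  + exists (asg z (hm (s' z)) (hm u0)) => [v qv|].
      by rewrite /asg; case: veqP => // e; rewrite -e s'E.
    by rewrite (sat_local _ _ _ bz) asg1 -tb1.
  + have [u [uE tE nE]] := pick_u z (s' z) u0 (s'E z).
    exists (asg z u u0) => [v qv|].
      by rewrite /asg; case: veqP => // e; rewrite uE // -e.
    by rewrite (sat_local _ _ _ bz) asg1 tb1 (ib _ _ tE).
Qed.

Lemma truth_all qx qy a g (f := FAll qx qy a g) :
  List.In (FAtom a) cl -> type_inv g -> truth g -> (forall z, fv g z -> avars a z) -> type_inv f -> truth f.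
Proof.
move=> acl ig tg fvg invf.
have [||||t1 t2] := @truth_ex qx qy a (FNeg g) acl.
- by move=> s s' e /=; rewrite (ig _ _ e).
- exact: truth_neg.
- exact: fvg.
- by move=> s s' e; have := invf _ _ e; rewrite !satAll => /negb_inj.
by split=> [u|v u w t e]; rewrite !satAll ?t1 // (t2 _ _ _ _ e).
Qed.

Lemma truth_subfmls :
  (forall f, gf2 f -> (forall h, List.In h (subfmls f) -> List.In h cl) ->
     forall h, List.In h (subfmls f) -> truth h) /\
  (forall ts v, gf2ts ts -> (forall h, List.In h (term_subfmls v ts) -> List.In h cl) ->
     forall h, List.In h (term_subfmls v ts) -> truth h).
Proof.
have quantE g a : [&& gf2 g, fv g vx ==> avars a vx & fv g vy ==> avars a vy] ->
    gf2 g /\ (forall z, fv g z -> avars a z).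
  by case/and3P => gg /implyP hx /implyP hy; split=> // -[].
apply: fml_sterm_ind.
- by move=> a _ incl h [<-|[]]; apply: truth_atom; apply: incl; left.
- by move=> z1 z2 _ incl h [<-|[]]; apply: truth_eq.
- move=> g IH gg incl h [<-|hg]; last by apply: IH hg => // h' h'g; apply: incl; right.
  by apply/truth_neg/IH => //; [move=> h' h'g; apply: incl; right|apply: In_subfmls].
- move=> g IHg k IHk /andP[gg gk] incl.
  have tg : forall h, List.In h (subfmls g) -> truth h.
    by apply: IHg => // h hg; apply: incl; right; apply/In_cat; left.
  have tk : forall h, List.In h (subfmls k) -> truth h.
    by apply: IHk => // h hk; apply: incl; right; apply/In_cat; right.
  move=> h [<-|/In_cat[/tg|/tk]] //.
  by apply: truth_and; [apply/tg/In_subfmls|apply/tk/In_subfmls].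
- move=> g IHg k IHk /andP[gg gk] incl.
  have tg : forall h, List.In h (subfmls g) -> truth h.
    by apply: IHg => // h hg; apply: incl; right; apply/In_cat; left.
  have tk : forall h, List.In h (subfmls k) -> truth h.
    by apply: IHk => // h hk; apply: incl; right; apply/In_cat; right.
  move=> h [<-|/In_cat[/tg|/tk]] //.
  by apply: truth_or; [apply/tg/In_subfmls|apply/tk/In_subfmls].
- move=> qx qy a g IH /quantE[gg fvg] incl.
  have tg : forall h, List.In h (subfmls g) -> truth h.
    by apply: IH => // h hg; apply: incl; right; right.
  have acl : List.In (FAtom a) cl by apply: incl; right; left.
  move=> h [<-|[<-|/tg//]]; last exact: truth_atom.
  apply: truth_ex => //; [|exact/tg/In_subfmls|]; apply: type_inv_cl; apply: incl; last by left.
  by right; right; apply: In_subfmls.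
- move=> qx qy a g IH /quantE[gg fvg] incl.
  have tg : forall h, List.In h (subfmls g) -> truth h.
    by apply: IH => // h hg; apply: incl; right; right.
  have acl : List.In (FAtom a) cl by apply: incl; right; left.
  move=> h [<-|[<-|/tg//]]; last exact: truth_atom.
  apply: truth_all => //; [|exact/tg/In_subfmls|]; apply: type_inv_cl; apply: incl; last by left.
  by right; right; apply: In_subfmls.
- move=> v ts IH c d /andP[gts _] incl.
  have tts : forall h, List.In h (term_subfmls v ts) -> truth h.
    by apply: IH => // h hts; apply: incl; right.
  move=> h [<-|/tts//]; apply: truth_pres => //; first by apply: incl; left.
  by move=> h' h'ts; apply: incl; right.
- by [].
- move=> lam R i g IHg r IHr v /andP[gg gr] incl h [<-|/In_cat[]].
  + by apply: truth_atom; apply: incl; left.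
  + by apply: IHg => // h' h'g; apply: incl; right; apply/In_cat; left.
  + by apply: IHr => // h' h'r; apply: incl; right; apply/In_cat; right.
Qed.

Lemma sat_sentence_transfer f (s : var -> M) (s' : var -> V) : gf2_sentence f ->
  (forall h, List.In h (subfmls f) -> List.In h cl) -> sat UN BN f s' = sat U B f s.
Proof.
case/and3P => gf nx ny incl.
have [t1 _] := truth_subfmls.1 f gf incl f (In_subfmls f).
have closed (K : finType) (UK : nat -> K -> bool) BK (r r' : var -> K) :
    sat UK BK f r = sat UK BK f r'.
  by apply: sat_fv => -[] hv; [rewrite hv in nx|rewrite hv in ny].
by rewrite (closed _ _ _ s' (fun=> s' vx)) t1; apply: closed.
Qed.

End Truth.

(** * Small model property *)

#[local] Arguments cpair : simpl never.

Lemma cpair_ge a b : a + b <= cpair a b.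
Proof.
rewrite /cpair leq_add2r; apply: leq_trans (leq_addr b a) _.
by case: (a + b) => // k; rewrite leq_divRL // leq_mul2l; lia.
Qed.

Fixpoint coef_norm (ts : sterm) : nat :=
  match ts with SNil => 0 | SCons lam _ _ _ r => `|lam|%N + coef_norm r end.

(** Order comparisons depend on the sign alone, hence the value 1. *)
Definition modulus (c : cmp) : nat :=
  match c with CCong d | CNCong d => maxn 1 d | _ => 1 end.

Lemma code_int_ge z : `|z|%N <= code_int z.
Proof. case: z => n; rewrite /= ?NegzE ?abszN /=; lia. Qed.

Lemma coef_norm_le ts : coef_norm ts <= code_ts ts.
Proof.
elim: ts => //= lam R i g r IH.
have := code_int_ge lam.
have h1 := cpair_ge (code_int lam) (cpair R (cpair (code_bool i) (cpair (code g) (code_ts r)))).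
have h2 := cpair_ge R (cpair (code_bool i) (cpair (code g) (code_ts r))).
have h3 := cpair_ge (code_bool i) (cpair (code g) (code_ts r)).
have h4 := cpair_ge (code g) (code_ts r).
lia.
Qed.

(** The factor 2 pays for the guard listed with each quantifier or term; the successor is there
    because an atom can have code 0. *)
Lemma size_subfmls_le : (forall f, size (subfmls f) <= (2 * code f).+1) /\
  (forall ts v, size (term_subfmls v ts) <= 2 * code_ts ts).
Proof.
apply: fml_sterm_ind => //=.
- by move=> g IH; have := cpair_ge 2 (code g); lia.
- move=> g IHg h IHh; rewrite size_cat.
  by have := cpair_ge 3 (cpair (code g) (code h)); have := cpair_ge (code g) (code h); lia.
- move=> g IHg h IHh; rewrite size_cat.
  by have := cpair_ge 4 (cpair (code g) (code h)); have := cpair_ge (code g) (code h); lia.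
- move=> qx qy a g IH.
  have := cpair_ge 5 (cpair (code_bool qx) (cpair (code_bool qy) (cpair (code_atom a) (code g)))).
  have := cpair_ge (code_bool qx) (cpair (code_bool qy) (cpair (code_atom a) (code g))).
  have := cpair_ge (code_bool qy) (cpair (code_atom a) (code g)).
  have := cpair_ge (code_atom a) (code g).
  lia.
- move=> qx qy a g IH.
  have := cpair_ge 6 (cpair (code_bool qx) (cpair (code_bool qy) (cpair (code_atom a) (code g)))).
  have := cpair_ge (code_bool qx) (cpair (code_bool qy) (cpair (code_atom a) (code g))).
  have := cpair_ge (code_bool qy) (cpair (code_atom a) (code g)).
  have := cpair_ge (code_atom a) (code g).
  lia.
- move=> v ts IH c d; have := IH v.
  have := cpair_ge 7 (cpair (code_var v) (cpair (code_ts ts) (cpair (code_cmp c) (code_int d)))).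
  have := cpair_ge (code_var v) (cpair (code_ts ts) (cpair (code_cmp c) (code_int d))).
  have := cpair_ge (code_ts ts) (cpair (code_cmp c) (code_int d)).
  lia.
- move=> lam R i g IHg r IHr v; rewrite size_cat; have := IHr v.
  have := cpair_ge (code_int lam) (cpair R (cpair (code_bool i) (cpair (code g) (code_ts r)))).
  have := cpair_ge R (cpair (code_bool i) (cpair (code g) (code_ts r))).
  have := cpair_ge (code_bool i) (cpair (code g) (code_ts r)).
  have := cpair_ge (code g) (code_ts r).
  lia.
Qed.

Lemma pres_in_subfmls_le v ts c d :
  (forall f, List.In (FPres v ts c d) (subfmls f) -> coef_norm ts + `|d| + modulus c <= (code f).+1) /\
  (forall us w, List.In (FPres v ts c d) (term_subfmls w us) -> coef_norm ts + `|d| + modulus c <= (code_ts us).+1).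
Proof.
set m := (_ + _).
apply: fml_sterm_ind => /=.
- by move=> a [].
- by move=> ? ? [].
- by move=> g IH [//|/IH]; have := cpair_ge 2 (code g); lia.
- move=> g IHg h IHh; have := cpair_ge 3 (cpair (code g) (code h)); have := cpair_ge (code g) (code h).
  by move=> h1 h2 [//|/In_cat[/IHg|/IHh]]; lia.
- move=> g IHg h IHh; have := cpair_ge 4 (cpair (code g) (code h)); have := cpair_ge (code g) (code h).
  by move=> h1 h2 [//|/In_cat[/IHg|/IHh]]; lia.
- move=> qx qy a g IH [//|[//|/IH]].
  have := cpair_ge 5 (cpair (code_bool qx) (cpair (code_bool qy) (cpair (code_atom a) (code g)))).
  have := cpair_ge (code_bool qx) (cpair (code_bool qy) (cpair (code_atom a) (code g))).
  have := cpair_ge (code_bool qy) (cpair (code_atom a) (code g)).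
  have := cpair_ge (code_atom a) (code g).
  lia.
- move=> qx qy a g IH [//|[//|/IH]].
  have := cpair_ge 6 (cpair (code_bool qx) (cpair (code_bool qy) (cpair (code_atom a) (code g)))).
  have := cpair_ge (code_bool qx) (cpair (code_bool qy) (cpair (code_atom a) (code g))).
  have := cpair_ge (code_bool qy) (cpair (code_atom a) (code g)).
  have := cpair_ge (code_atom a) (code g).
  lia.
- move=> v' ts' IH c' d'.
  have := cpair_ge 7 (cpair (code_var v') (cpair (code_ts ts') (cpair (code_cmp c') (code_int d')))).
  have := cpair_ge (code_var v') (cpair (code_ts ts') (cpair (code_cmp c') (code_int d'))).
  have := cpair_ge (code_ts ts') (cpair (code_cmp c') (code_int d')).
  have := cpair_ge (code_cmp c') (code_int d').
  have h := coef_norm_le ts'; have hd := code_int_ge d'.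
  have hc : modulus c' <= (code_cmp c').+1.
    by case: (c') => //= k; [have := cpair_ge 6 k|have := cpair_ge 7 k]; lia.
  move=> h1 h2 h3 h4 [e|/IH]; last by lia.
  by rewrite /m; case: e => _ <- <- <-; lia.
- by [].
- move=> lam R i g IHg r IHr w.
  have := cpair_ge (code_int lam) (cpair R (cpair (code_bool i) (cpair (code g) (code_ts r)))).
  have := cpair_ge R (cpair (code_bool i) (cpair (code g) (code_ts r))).
  have := cpair_ge (code_bool i) (cpair (code g) (code_ts r)).
  have := cpair_ge (code g) (code_ts r).
  by move=> h1 h2 h3 h4 [//|/In_cat[/IHg|/IHr]]; lia.
Qed.

Lemma In_nth (A : Type) (x0 x : A) (s : seq A) : List.In x s -> exists2 j, j < size s & nth x0 s j = x.
Proof.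
elim: s => //= y s IHs [->|/IHs[j js <-]]; first by exists 0.
by exists j.+1.
Qed.

Section Bounds.
Variables (M : finType) (U : nat -> M -> bool) (B : nat -> M -> M -> bool) (cl : seq fml) (m0 : M).
Local Open Scope ring_scope.

Lemma self_weight_le v ts a : `|self_weight U B v ts a| <= (coef_norm ts)%:Z.
Proof.
elim: ts => [|lam R i g r IH] /=; first by rewrite normr0.
by case: (_ && _) => /=; rewrite ?mulr1 ?mulr0; lia.
Qed.

Lemma type_weight_le v ts t : `|type_weight U B (cl := cl) m0 v ts t| <= (coef_norm ts)%:Z.
Proof.
elim: ts => [|lam R i g r IH] /=; first by rewrite normr0.
by case: (_ && _) => /=; rewrite ?mulr1 ?mulr0; lia.
Qed.

End Bounds.

Section Signs.
Local Open Scope ring_scope.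

Lemma cmp_holds_congr (c : cmp) (x y d : int) : sgz (x - d) = sgz (y - d) ->
  (exists k : int, x - y = k * (modulus c)%:Z) -> cmp_holds c x d = cmp_holds c y d.
Proof.
have eqE z : (z == d) = (sgz (z - d) == 0) by rewrite sgz_eq0 subr_eq0.
have ltE z : (z < d) = (sgz (z - d) < 0) by rewrite sgz_lt0 subr_lt0.
have leE z : (z <= d) = (sgz (z - d) <= 0) by rewrite sgz_le0 subr_le0.
have gtE z : (z > d) = (sgz (z - d) > 0) by rewrite sgz_gt0 subr_gt0.
have geE z : (z >= d) = (sgz (z - d) >= 0) by rewrite sgz_ge0 subr_ge0.
move=> sE [k kE].
have modE m : modulus c = maxn 1 m -> (x == d %[mod m%:Z])%Z = (y == d %[mod m%:Z])%Z.
  (* Congruence modulo 0 is equality, which the sign decides. *)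
  move=> mE; case: m mE => [|m] mE; first by rewrite !modz0 !eqE sE.
  by rewrite -(subrK y x) kE (_ : modulus c = m.+1) ?modzMDl // mE; lia.
case: c {kE} modE => [||||||m|m] modE /=; rewrite ?eqE ?leE ?ltE ?geE ?gtE ?sE //; by rewrite modE.
Qed.

Lemma sgz_step (x e : int) (m : nat) : sgz x = e -> sgz (x + m%:Z * e) = e.
Proof.
move=> <-; case: (sgzP x) => h; rewrite ?mulr0 ?addr0 ?mulr1 ?h ?sgz0 //.
  by apply: gtr0_sgz; lia.
by apply: ltr0_sgz; lia.
Qed.

End Signs.

(** [n] bounds the number of subformulas and all numbers in the constraints; [t] counts the 2-types,
    made of four truth vectors; [b] is [local_bound]. A class consists of a type, a set of neighbour
    types and a sign for each constraint, so [s] is the number of classes times the size of a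
    balanced piece. The last line is the vertex count of [balanced_realization], with [s * b]
    bounding the number of darts. *)
Definition model_bound (c : nat) : nat :=
  let n := (2 * c).+1 in
  let t := 2 ^ (4 * n) in
  let b := t.+1 * zs_bound n (2 * n) in
  let s := t * 2 ^ t * 3 ^ n * zs_bound t b in
  s * 2 * (s * b).+1.

Lemma card_ttype (cl : seq fml) : #|ttype cl| = 2 ^ (4 * size cl).
Proof. by rewrite !card_prod !card_tuple card_bool -!expnD; congr (2 ^ _); lia. Qed.

Lemma small_model f : gf2_sentence f -> fin_sat f ->
  exists (V : finType) (u0 : V) (U : nat -> V -> bool) (B : nat -> V -> V -> bool),
    sat U B f (fun=> u0) /\ #|V| <= model_bound (code f).
Proof.
move=> fS [M [m0 [U [B satf]]]].
pose n := (2 * code f).+1.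
(* Padding with trivial equalities gives the list length exactly [n], so the number of types is an
   equation in [n]. *)
pose cl := subfmls f ++ nseq (n - size (subfmls f)) (FEq vx vx).
have szcl : size cl = n by rewrite size_cat size_nseq subnKC // size_subfmls_le.1.
have sub_cl h : List.In h (subfmls f) -> List.In h cl by move=> hf; apply/In_cat; left.
(* Every position of [cl] carries a constraint; those without a Presburger formula get an empty
   sum. *)
pose js j := if nth (FEq vx vx) cl j is FPres v ts c d then (v, ts, c, d) else (vx, SNil, CEq, 0%R).
pose L j (t : ttype cl) := type_weight U B m0 (js j).1.1.1 (js j).1.1.2 t.
pose c a j := (self_weight U B (js j).1.1.1 (js j).1.1.2 a - (js j).2)%R.
pose d j := modulus (js j).1.2.
pose nbs := nb_types U B cl.
have js_le j : coef_norm (js j).1.1.2 + `|(js j).2| + modulus (js j).1.2 <= n.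
  rewrite /js; case E: (nth _ _ _) => [| | | | | | |v ts cc dd] //=.
  have [jn|jn] := ltnP j (size cl); last by rewrite nth_default in E.
  have : List.In (FPres v ts cc dd) cl.
    by rewrite -E; elim: (cl) j jn {E} => // x l IHl [|j] /= jl; [left|right; apply: IHl].
  case/In_cat => [/(pres_in_subfmls_le _ _ _ _).1|]; first by rewrite /n; lia.
  by elim: (n - _) => //= k IHk [].
have d_gt0 j : 0 < d j by rewrite /d; case: (js j).1.2 => //= k; lia.
have L_le j t : j < n -> (`|L j t| <= n%:Z)%R.
  by move=> _; have := js_le j; have := @type_weight_le _ U B cl m0 (js j).1.1.1 (js j).1.1.2 t; rewrite /L; lia.
have c_le a j : j < n -> (`|c a j| <= n%:Z)%R.
  by move=> _; have := js_le j; have := @self_weight_le _ U B (js j).1.1.1 (js j).1.1.2 a; rewrite /c; lia.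
have d_le j : j < n -> d j <= n by move=> _; have := js_le j; rewrite /d; lia.
have /fin_all_exists[base /fin_all_exists[ps dec]] a :=
  @local_decomposition _ n n L d L_le d_gt0 d_le (nbs a) (c a) (c_le a).
pose e a j := sgz (c a j + \sum_(t <- nbs a) L j t)%R.
pose b := local_bound (ttype cl) n n.
pose K : finType := (ttype cl * {set ttype cl} * {ffun 'I_n -> 'I_3})%type.
pose kappa a : K := (pair_type U B cl a a, [set t in nbs a], [ffun j : 'I_n => inord `|(e a j + 1)%R|%N]).
have kappaE a a' : kappa a = kappa a' ->
    [/\ pair_type U B cl a a = pair_type U B cl a' a', nbs a =i nbs a' & forall j, j < n -> e a j = e a' j].
  move=> kE; split=> [|t|j jn].
  - by have := congr1 (fun k : K => k.1.1) kE.
  - by have := congr1 (fun k : K => t \in k.1.2) kE; rewrite /= !inE.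
  - have := congr1 (fun k : K => val (k.2 (Ordinal jn))) kE; rewrite /= !ffunE /=.
    have e_le a1 : (`|e a1 j| <= 1)%R by rewrite /e; case: sgzP.
    by have h1 := e_le a; have h2 := e_le a'; rewrite !inordK; lia.
(* Double counting: an edge from a to a' of type t is an edge from a' to a of the converse type. *)
have bal t : \sum_a count_mem t (nbs a) = \sum_a count_mem (conv_type t) (nbs a).
  under eq_bigr do rewrite count_nb_types -sum1_card big_mkcond.
  under [RHS]eq_bigr do rewrite count_nb_types -sum1_card big_mkcond.
  rewrite exchange_big /=; apply: eq_bigr => a _; apply: eq_bigr => a' _.
  rewrite !inE /edge_type (edgeC U B cl a' a) (pair_typeC U B cl a a').
  case: (edge U B cl a a') => //.
  by rewrite !(inj_eq Some_inj) (can2_eq (@conv_typeK cl) (@conv_typeK cl)).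
have [] := @bounded_balanced_system M (ttype cl) K (@conv_type cl) nbs base ps kappa b.
- by move=> a; have [] := dec a.
- by move=> a; have [] := dec a.
- exact: bal.
move=> n0 [h [F [Fbal Fdec hsurj n0_le szF]]].
have [V [pr [lab [pr_surj lab_sw lab_irr lab_count szV]]]] :=
  balanced_realization (@conv_typeK cl) Fbal.
have supp i : F i =i nbs (h i).
  move=> t; have [qs [-> qsP]] := Fdec i.
  have [pbase _ sbase _ _] := dec (h i).
  apply/idP/idP => [|/sbase]; last by rewrite mem_cat => ->.
  rewrite mem_cat => /orP[tb|/flattenP[q /qsP[a /kappaE[_ nE _] qa] tq]].
    by rewrite -(perm_mem pbase) mem_cat tb.
  have [pbase' _ _ _ _] := dec a.
  rewrite -nE -(perm_mem pbase') mem_cat; apply/orP; right.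
  by apply/flattenP; exists q.
have pres i v ts cc dd : List.In (FPres v ts cc dd) cl ->
  cmp_holds cc (self_weight U B v ts (h i) + \sum_(t <- F i) type_weight U B m0 v ts t)%R dd =
  cmp_holds cc (self_weight U B v ts (h i) + \sum_(t <- nbs (h i)) type_weight U B m0 v ts t)%R dd.
  move=> /(In_nth (FEq vx vx))[j jn jE]; rewrite szcl in jn.
  have jsE : js j = (v, ts, cc, dd) by rewrite /js jE.
  have [pbase _ _ sgbase psE] := dec (h i).
  pose x := (c (h i) j + \sum_(t <- base (h i)) L j t)%R.
  (* Foreign periods are admissible since their owners have the same signs as [h i], signs being
     part of the class. *)
  have multE qs : (forall q, q \in qs -> exists2 a, kappa a = kappa (h i) & q \in ps a) ->
      exists m : nat, (\sum_(t <- flatten qs) L j t = (m * d j)%:Z * e (h i) j)%R.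
    elim: qs => [|q qs IHqs] qsP; first by exists 0; rewrite big_nil mul0r.
    have [|m mE] := IHqs; first by move=> q' q'qs; apply: qsP; rewrite inE q'qs orbT.
    have [a /kappaE[_ _ eE] qa] := qsP q (mem_head _ _).
    have [_ _ _ _ /(_ q j qa jn)[m' m'E]] := dec a.
    exists (m' + m); rewrite /= big_cat /= mE m'E -/(e a j) eE // mulnDl PoszD.
    by rewrite mulrDl.
  have [qs [FE qsP]] := Fdec i.
  have [m mE] := multE qs qsP.
  have [m' m'E] := multE (ps (h i)) (fun q hq => ex_intro2 _ _ (h i) erefl hq).
  have sx : sgz x = e (h i) j by apply: sgbase.
  have y1 : (self_weight U B v ts (h i) + \sum_(t <- F i) type_weight U B m0 v ts t - dd = x + (m * d j)%:Z * e (h i) j)%R.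
    by rewrite -mE FE big_cat /= /x /c /L jsE /=; ring.
  have y2 : (self_weight U B v ts (h i) + \sum_(t <- nbs (h i)) type_weight U B m0 v ts t - dd = x + (m' * d j)%:Z * e (h i) j)%R.
    by rewrite -m'E -(perm_big _ pbase) big_cat /= /x /c /L jsE /=; ring.
  apply: cmp_holds_congr; first by rewrite y1 y2 !sgz_step.
  exists ((m%:Z - m'%:Z) * e (h i) j)%R.
  have -> : Posz (modulus cc) = Posz (d j) by rewrite /d jsE.
  transitivity ((x + (m * d j)%:Z * e (h i) j) - (x + (m' * d j)%:Z * e (h i) j))%R.
    by rewrite -y1 -y2; ring.
  by rewrite !PoszM; ring.
have surj a : exists u, pair_type U B cl (h (pr u)) (h (pr u)) = pair_type U B cl a a /\ nbs (h (pr u)) =i nbs a.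
  have [i /kappaE[k1 k2 _]] := hsurj a; have [u uE] := pr_surj i.
  by exists u; rewrite uE.
have tr := @sat_sentence_transfer M U B cl m0 V (h \o pr) lab (F \o pr) lab_sw lab_irr lab_count
  (fun u => supp (pr u)) surj (fun u => pres (pr u)) f.
have [u0 _] := surj m0.
exists V, u0, (UN U (h \o pr)), (BN U B m0 (h \o pr) lab); split.
  by rewrite (tr (fun=> m0)).
rewrite szV card_ord /model_bound -/n.
have cT := card_ttype cl; rewrite szcl in cT.
have cK : #|K| = 2 ^ (4 * n) * 2 ^ (2 ^ (4 * n)) * 3 ^ n.
  have cS : #|{set ttype cl}| = 2 ^ #|ttype cl|.
    by rewrite -[LHS]cardsT -powersetT card_powerset cardsT.
  by rewrite 2!card_prod cS cT card_ffun !card_ord.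
have bE : b = (2 ^ (4 * n)).+1 * zs_bound n (2 * n) by rewrite /b /local_bound cT.
rewrite -cT in cK bE *; rewrite -bE; rewrite cK in n0_le szF.
by apply: leq_mul; [rewrite leq_mul2r n0_le orbT|rewrite ltnS].
Qed.

(** * Recursive functions *)

(** The functions act on argument lists so that closure lemmas can be selected by the shape of the
    body. *)
Definition pr (k : nat) (F : seq nat -> nat) : Prop :=
  exists r, forall xs, size xs = k -> eval r xs (F xs).

Lemma pr_ext k F G : (forall xs, size xs = k -> F xs = G xs) -> pr k F -> pr k G.
Proof. by move=> e [r h]; exists r => xs sz; rewrite -e //; apply: h. Qed.

Lemma pr_var k i : pr k (fun xs => nth 0 xs i).
Proof. by exists (RProj i) => xs _; constructor. Qed.

(** A bounded sum or quantifier puts its variable in front and passes [drop 1] to the body, so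
    nested binders produce nested drops; the three binders of [search] give the deepest case. *)
Lemma pr_drop_var k i j : pr k (fun xs => nth 0 (drop i xs) j).
Proof. by apply: pr_ext (pr_var k (i + j)) => xs _; rewrite nth_drop. Qed.

Lemma pr_drop2_var k i i' j : pr k (fun xs => nth 0 (drop i (drop i' xs)) j).
Proof. by apply: pr_ext (pr_var k (i' + (i + j))) => xs _; rewrite !nth_drop. Qed.

Lemma pr_drop3_var k i i' i'' j : pr k (fun xs => nth 0 (drop i (drop i' (drop i'' xs))) j).
Proof. by apply: pr_ext (pr_var k (i'' + (i' + (i + j)))) => xs _; rewrite !nth_drop. Qed.

Lemma pr_comp k (F : seq nat -> nat) (Gs : seq (seq nat -> nat)) :
  pr (size Gs) F -> foldr (fun G P => pr k G /\ P) True Gs ->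
  pr k (fun xs => F [seq G xs | G <- Gs]).
Proof.
move=> [rF hF] hG.
have [rs hrs] : exists rs, forall xs, size xs = k -> evals rs xs [seq G xs | G <- Gs].
  elim: Gs hG {rF F hF} => [|G Gs IH] /=; first by exists [::] => xs _; constructor.
  by move=> [[r hr] /IH[rs hrs]]; exists (r :: rs) => xs sz; constructor; auto.
exists (RComp rF rs) => xs sz; apply: eComp (hrs _ sz) _.
by apply: hF; rewrite size_map.
Qed.

Lemma pr_succ k A : pr k A -> pr k (fun xs => (A xs).+1).
Proof.
move=> hA; apply: (@pr_comp k (fun xs => (head 0 xs).+1) [:: A]) => //=.
by exists RSucc => xs _; constructor.
Qed.

Lemma pr_const k c : pr k (fun=> c).
Proof.
elim: c => [|c IH]; first by exists RZero => xs _; constructor.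
exact: pr_succ IH.
Qed.

Lemma pr_rec k N A (S : nat -> nat -> seq nat -> nat) :
  pr k N -> pr k A -> pr k.+2 (fun ys => S (nth 0 ys 0) (nth 0 ys 1) (drop 2 ys)) ->
  pr k (fun xs => iteri (N xs) (fun n r => S n r xs) (A xs)).
Proof.
move=> [rN hN] [rA hA] [rS hS].
exists (RComp (RPrec rA rS) (rN :: [seq RProj i | i <- iota 0 k])) => xs sz.
apply: (@eComp _ _ _ (N xs :: xs)).
  constructor; first exact: hN.
  rewrite -{2}(mkseq_nth 0 xs) /mkseq sz; elim: (iota 0 k) => [|i l IH] /=; constructor => //.
  by constructor.
elim: (N xs) => [|n IH] /=; first by constructor; apply: hA.
apply: ePrecS IH _; set r := iteri _ _ _.
by have := hS [:: n, r & xs]; rewrite /= drop0 sz; apply.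
Qed.

Lemma pr_app1 (f : nat -> nat) : pr 1 (fun xs => f (nth 0 xs 0)) ->
  forall k A, pr k A -> pr k (fun xs => f (A xs)).
Proof. by move=> hf k A hA; apply: (@pr_comp k _ [:: A] hf). Qed.

Lemma pr_app2 (f : nat -> nat -> nat) : pr 2 (fun xs => f (nth 0 xs 0) (nth 0 xs 1)) ->
  forall k A B, pr k A -> pr k B -> pr k (fun xs => f (A xs) (B xs)).
Proof. by move=> hf k A B hA hB; apply: (@pr_comp k _ [:: A; B] hf). Qed.

Lemma pr_pred k A : pr k A -> pr k (fun xs => (A xs).-1).
Proof.
move=> hA; apply: pr_ext (pr_rec (S := fun n _ _ => n) hA (pr_const k 0) (pr_var _ 0)) => xs _.
by case: (A xs).
Qed.

Lemma pr_add k A B : pr k A -> pr k B -> pr k (fun xs => A xs + B xs).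
Proof.
move=> hA hB; apply: pr_ext (pr_rec (S := fun _ r _ => r.+1) hB hA (pr_succ (pr_var _ 1))) => xs _.
by elim: (B xs) => [|n IH] /=; rewrite ?addn0 // IH addnS.
Qed.

Lemma pr_sub k A B : pr k A -> pr k B -> pr k (fun xs => A xs - B xs).
Proof.
move=> hA hB; apply: pr_ext (pr_rec (S := fun _ r _ => r.-1) hB hA (pr_pred (pr_var _ 1))) => xs _.
by elim: (B xs) => [|n IH] /=; rewrite ?subn0 // IH subnS.
Qed.

Definition bsum (n : nat) (g : nat -> nat) : nat := \sum_(i < n) g i.

Lemma pr_bsum k N (G : nat -> seq nat -> nat) :
  pr k N -> pr k.+1 (fun ys => G (nth 0 ys 0) (drop 1 ys)) ->
  pr k (fun xs => bsum (N xs) (fun i => G i xs)).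
Proof.
move=> hN hG.
(* In the recursion step the accumulator stands at position 1; composing with projections skips
   it. *)
have hG' : pr k.+2 (fun ys => G (nth 0 ys 0) (drop 2 ys)).
  have := @pr_comp k.+2 _ ((fun ys => nth 0 ys 0) :: [seq (fun ys => nth 0 (drop 2 ys) i) | i <- iota 0 k]).
  rewrite /= size_map size_iota => /(_ _ hG) h; apply: pr_ext (h _) => [ys sz|].
    congr (G _ _); rewrite -map_comp /= ?drop0.
    have -> : k = size (drop 2 ys) by rewrite size_drop sz; lia.
    exact: (mkseq_nth 0).
  split; first exact: pr_var.
  by elim: (iota 0 k) => //= i l IH; split => //; apply: pr_drop_var.
apply: pr_ext (pr_rec (S := fun n r xs => r + G n xs) hN (pr_const k 0) (pr_add (pr_var _ 1) hG')) => xs _.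
by rewrite /bsum; elim: (N xs) => [|n IH]; rewrite ?big_ord0 // big_ord_recr /= IH.
Qed.

Lemma pr_mul k A B : pr k A -> pr k B -> pr k (fun xs => A xs * B xs).
Proof.
move=> hA hB.
apply: pr_ext (@pr_rec k B (fun=> 0) (fun _ r xs => r + A xs) hB (pr_const k 0) _) => [xs _|].
  by elim: (B xs) => [|n IH] /=; rewrite ?muln0 // IH mulnS addnC.
apply: pr_add; first exact: pr_var.
case: hA => r hr.
exists (RComp r [seq RProj i.+2 | i <- iota 0 k]) => ys sz; apply: (@eComp _ _ _ (drop 2 ys)); last first.
  by apply: hr; rewrite size_drop sz; lia.
have sz' : k = size (drop 2 ys) by rewrite size_drop sz; lia.
have -> : drop 2 ys = [seq nth 0 ys i.+2 | i <- iota 0 k].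
  by rewrite sz' -[LHS](mkseq_nth 0); apply: eq_map => i; rewrite nth_drop.
by elim: (iota 0 k) => [|i l IH] /=; constructor => //; constructor.
Qed.

Notation prb k P := (pr k (fun xs => nat_of_bool (P xs))).

Lemma prb_not k (P : seq nat -> bool) : prb k P -> prb k (fun xs => ~~ P xs).
Proof.
by move=> h; apply: pr_ext (pr_sub (pr_const k 1) h) => xs _; case: (P xs).
Qed.

Lemma prb_and k (P Q : seq nat -> bool) : prb k P -> prb k Q -> prb k (fun xs => P xs && Q xs).
Proof.
by move=> hP hQ; apply: pr_ext (pr_mul hP hQ) => xs _; case: (P xs); case: (Q xs).
Qed.

Lemma prb_or k (P Q : seq nat -> bool) : prb k P -> prb k Q -> prb k (fun xs => P xs || Q xs).
Proof.
move=> hP hQ; apply: pr_ext (prb_not (prb_and (prb_not hP) (prb_not hQ))) => xs _.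
by case: (P xs); case: (Q xs).
Qed.

Lemma pr_if k (P : seq nat -> bool) A B : prb k P -> pr k A -> pr k B ->
  pr k (fun xs => if P xs then A xs else B xs).
Proof.
move=> hP hA hB.
apply: pr_ext (pr_add (pr_mul hP hA) (pr_mul (prb_not hP) hB)) => xs _.
by case: (P xs); rewrite /= ?mul1n ?mul0n ?addn0.
Qed.

Lemma prb_if k (P Q R : seq nat -> bool) : prb k P -> prb k Q -> prb k R ->
  prb k (fun xs => if P xs then Q xs else R xs).
Proof.
move=> hP hA hB; apply: pr_ext (pr_if hP hA hB) => xs _; by case: (P xs).
Qed.

Lemma prb_leq k A B : pr k A -> pr k B -> prb k (fun xs => A xs <= B xs).
Proof.
move=> hA hB; apply: pr_ext (pr_sub (pr_const k 1) (pr_sub hA hB)) => xs _.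
by case: leqP => h; lia.
Qed.

Lemma prb_eq k A B : pr k A -> pr k B -> prb k (fun xs => A xs == B xs).
Proof.
move=> hA hB; apply: pr_ext (prb_and (prb_leq hA hB) (prb_leq hB hA)) => xs _.
by rewrite eqn_leq.
Qed.

Definition bex (n : nat) (p : nat -> bool) : bool := has p (iota 0 n).

Lemma bexP n (p : nat -> bool) : reflect (exists2 i, i < n & p i) (bex n p).
Proof.
apply: (iffP hasP) => [[i]|[i ip]]; first by rewrite mem_iota => /andP[_ ?]; exists i.
by exists i; rewrite ?mem_iota.
Qed.

Lemma prb_bex k N (P : nat -> seq nat -> bool) :
  pr k N -> prb k.+1 (fun ys => P (nth 0 ys 0) (drop 1 ys)) ->
  prb k (fun xs => bex (N xs) (fun i => P i xs)).
Proof.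
move=> hN hP.
apply: pr_ext (prb_not (prb_leq (pr_bsum (G := fun i xs => nat_of_bool (P i xs)) hN hP) (pr_const k 0))) => xs _.
rewrite -ltnNge; congr nat_of_bool; apply/idP/bexP => [|[i iN Pi]].
  rewrite lt0n sum_nat_eq0 => /forallPn[i]; rewrite implyTb eqb0 negbK => h.
  by exists i.
by rewrite /bsum (bigD1 (Ordinal iN)) //= Pi.
Qed.

Ltac prs_base := cbv beta; lazymatch goal with
  | |- pr _ (fun _ => ?c) => exact (pr_const _ c)
  | |- pr _ (fun xs => nth 0 xs ?i) => exact (pr_var _ i)
  | |- pr _ (fun xs => nth 0 (drop ?i xs) ?j) => exact (pr_drop_var _ i j)
  | |- pr _ (fun xs => nth 0 (drop ?i (drop ?i' xs)) ?j) => exact (pr_drop2_var _ i i' j)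
  | |- pr _ (fun xs => nth 0 (drop ?i (drop ?i' (drop ?i'' xs))) ?j) =>
      exact (pr_drop3_var _ i i' i'' j)
  | |- pr _ (fun xs => S (@?A xs)) => refine (@pr_succ _ A _)
  | |- pr _ (fun xs => predn (@?A xs)) => refine (@pr_pred _ A _)
  | |- pr _ (fun xs => addn (@?A xs) (@?B xs)) => refine (@pr_add _ A B _ _)
  | |- pr _ (fun xs => subn (@?A xs) (@?B xs)) => refine (@pr_sub _ A B _ _)
  | |- pr _ (fun xs => muln (@?A xs) (@?B xs)) => refine (@pr_mul _ A B _ _)
  | |- pr _ (fun xs => bsum (@?A xs) (fun i => @?B i xs)) => refine (@pr_bsum _ A B _ _)
  | |- pr _ (fun xs => nat_of_bool (negb (@?A xs))) => refine (@prb_not _ A _)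
  | |- pr _ (fun xs => nat_of_bool (andb (@?A xs) (@?B xs))) => refine (@prb_and _ A B _ _)
  | |- pr _ (fun xs => nat_of_bool (orb (@?A xs) (@?B xs))) => refine (@prb_or _ A B _ _)
  | |- pr _ (fun xs => nat_of_bool (leq (@?A xs) (@?B xs))) => refine (@prb_leq _ A B _ _)
  | |- pr _ (fun xs => nat_of_bool (@eq_op _ (@?A xs) (@?B xs))) => refine (@prb_eq _ A B _ _)
  | |- pr _ (fun xs => nat_of_bool (bex (@?A xs) (fun i => @?B i xs))) => refine (@prb_bex _ A B _ _)
  end.
Ltac prs_more := fail.
Ltac prs_if := lazymatch goal with |- pr _ ?F =>
    let b := eval cbv beta in (F [::]) in
    lazymatch b with
    | if _ then _ else _ => apply: pr_if
    | nat_of_bool (if _ then _ else _) => apply: prb_if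
    end
  end.
Ltac prs := repeat first [prs_base | prs_more | prs_if].

Lemma pr_exp k A B : pr k A -> pr k B -> pr k (fun xs => A xs ^ B xs).
Proof.
apply: (@pr_app2 expn).
apply: pr_ext (@pr_rec 2 (fun xs => nth 0 xs 1) (fun=> 1) (fun _ r xs => nth 0 xs 0 * r) _ _ _) => [xs _|||]; prs.
by elim: (nth 0 xs 1) => //= n ->; rewrite expnS.
Qed.

(** The quotient of a by a nonzero b is the number of i below a with (i + 1) b at most a. *)
Lemma pr_div k A B : pr k A -> pr k B -> pr k (fun xs => A xs %/ B xs).
Proof.
apply: (@pr_app2 divn).
apply: (@pr_ext 2 (fun xs => if nth 0 xs 1 == 0 then 0 else
   bsum (nth 0 xs 0) (fun i => i.+1 * nth 0 xs 1 <= nth 0 xs 0))); last by prs.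
move=> xs _; move: (nth 0 xs 0) (nth 0 xs 1) => a b.
case: eqP => [->|/eqP b0]; first by rewrite divn0.
have cnt n c : bsum n (fun i => i < c) = minn n c.
  by rewrite /bsum; elim: n => [|n IH]; rewrite ?big_ord0 ?big_ord_recr /= ?IH; lia.
have := cnt a (a %/ b); rewrite /bsum; under eq_bigr do rewrite leq_divRL ?lt0n //.
by move=> ->; rewrite (minn_idPr _) // leq_div.
Qed.

Lemma pr_mod k A B : pr k A -> pr k B -> pr k (fun xs => A xs %% B xs).
Proof.
move=> hA hB; apply: pr_ext (pr_sub hA (pr_mul (pr_div hA hB) hB)) => xs _.
by rewrite {1}(divn_eq (A xs) (B xs)) addKn.
Qed.

Lemma prb_odd k A : pr k A -> prb k (fun xs => odd (A xs)).
Proof. by move=> hA; apply: pr_ext (pr_mod hA (pr_const k 2)) => xs _; rewrite modn2. Qed.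

Lemma pr_iter (f : nat -> nat) : pr 1 (fun xs => f (nth 0 xs 0)) ->
  forall k N A, pr k N -> pr k A -> pr k (fun xs => iter (N xs) f (A xs)).
Proof.
move=> hf k N A hN hA.
apply: pr_ext (pr_rec (S := fun _ r _ => f r) hN hA (pr_app1 hf (pr_var _ 1))) => xs _.
by elim: (N xs) => //= n ->.
Qed.

(** Inverts [cpair] by exhaustive search: components never exceed the code, and by injectivity a
    single summand can be nonzero. *)
Definition cfst (z : nat) : nat :=
  bsum z.+1 (fun a => bsum z.+1 (fun b => if cpair a b == z then a else 0)).
Definition csnd (z : nat) : nat :=
  bsum z.+1 (fun a => bsum z.+1 (fun b => if cpair a b == z then b else 0)).

(** From s to s + 1 the triangular numbers grow by s + 1, more than any second component on diagonal
    s, so the code determines the diagonal. *)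
Lemma cpair_inj a b a' b' : cpair a b = cpair a' b' -> a = a' /\ b = b'.
Proof.
have step s : (s.+1 * s.+2) %/ 2 = (s * s.+1) %/ 2 + s.+1.
  by rewrite (_ : s.+1 * s.+2 = s.+1 * 2 + s * s.+1) ?divnMDl //; lia.
have mono s s' : s <= s' -> (s * s.+1) %/ 2 <= (s' * s'.+1) %/ 2.
  by move=> h; apply: leq_div2r; apply: leq_mul.
have lt s s' : s < s' -> (s * s.+1) %/ 2 + s.+1 <= (s' * s'.+1) %/ 2.
  by move=> h; rewrite -step; apply: mono.
rewrite /cpair => e; have [h|h|h] := ltngtP (a + b) (a' + b').
- by have := lt _ _ h; lia.
- by have := lt _ _ h; lia.
- by move: e; rewrite h; lia.
Qed.

Lemma bsum_only n i (g : nat -> nat) : i < n -> (forall j, j != i -> g j = 0) -> bsum n g = g i.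
Proof.
move=> lt h; rewrite /bsum (bigD1 (Ordinal lt)) //= big1 ?addn0 // => j ne.
by apply: h; move: ne; rewrite -val_eqE.
Qed.

Lemma cpairK1 a b : cfst (cpair a b) = a.
Proof.
have := cpair_ge a b => h.
have E a' b' : (cpair a' b' == cpair a b) = (a' == a) && (b' == b).
  by apply/eqP/andP => [/cpair_inj[-> ->]|[/eqP-> /eqP->]].
rewrite /cfst (@bsum_only _ a) => [||j /negbTE ja]; [|lia|].
  rewrite (@bsum_only _ b) => [||j /negbTE jb]; [|lia|]; first by rewrite eqxx.
  by rewrite E jb andbF.
by rewrite /bsum big1 // => i _; rewrite E ja.
Qed.

Lemma cpairK2 a b : csnd (cpair a b) = b.
Proof.
have := cpair_ge a b => h.
have E a' b' : (cpair a' b' == cpair a b) = (a' == a) && (b' == b).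
  by apply/eqP/andP => [/cpair_inj[-> ->]|[/eqP-> /eqP->]].
rewrite /csnd (@bsum_only _ a) => [||j /negbTE ja]; [|lia|].
  rewrite (@bsum_only _ b) => [||j /negbTE jb]; [|lia|]; first by rewrite eqxx.
  by rewrite E jb andbF.
by rewrite /bsum big1 // => i _; rewrite E ja.
Qed.

Ltac prs_more ::= lazymatch goal with
  | |- pr _ (fun xs => expn (@?A xs) (@?B xs)) => refine (@pr_exp _ A B _ _)
  | |- pr _ (fun xs => divn (@?A xs) (@?B xs)) => refine (@pr_div _ A B _ _)
  | |- pr _ (fun xs => modn (@?A xs) (@?B xs)) => refine (@pr_mod _ A B _ _)
  | |- pr _ (fun xs => nat_of_bool (odd (@?A xs))) => refine (@prb_odd _ A _)
  end.

Lemma pr_cpair k A B : pr k A -> pr k B -> pr k (fun xs => cpair (A xs) (B xs)).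
Proof. by apply: (@pr_app2 cpair); rewrite /cpair; prs. Qed.

Lemma pr_cfst k A : pr k A -> pr k (fun xs => cfst (A xs)).
Proof. by apply: (@pr_app1 cfst); rewrite /cfst /cpair; prs. Qed.

Lemma pr_csnd k A : pr k A -> pr k (fun xs => csnd (A xs)).
Proof. by apply: (@pr_app1 csnd); rewrite /csnd /cpair; prs. Qed.

Lemma pr_iter_csnd k A B : pr k A -> pr k B -> pr k (fun xs => iter (A xs) csnd (B xs)).
Proof. by apply: pr_iter; exact: pr_csnd (pr_var _ _). Qed.

Ltac prs_more ::= lazymatch goal with
  | |- pr _ (fun xs => expn (@?A xs) (@?B xs)) => refine (@pr_exp _ A B _ _)
  | |- pr _ (fun xs => divn (@?A xs) (@?B xs)) => refine (@pr_div _ A B _ _)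
  | |- pr _ (fun xs => modn (@?A xs) (@?B xs)) => refine (@pr_mod _ A B _ _)
  | |- pr _ (fun xs => nat_of_bool (odd (@?A xs))) => refine (@prb_odd _ A _)
  | |- pr _ (fun xs => cpair (@?A xs) (@?B xs)) => refine (@pr_cpair _ A B _ _)
  | |- pr _ (fun xs => cfst (@?A xs)) => refine (@pr_cfst _ A _)
  | |- pr _ (fun xs => csnd (@?A xs)) => refine (@pr_csnd _ A _)
  | |- pr _ (fun xs => iter (@?A xs) csnd (@?B xs)) => refine (@pr_iter_csnd _ A B _ _)
  end.

(** * Model checking on codes *)

Definition bit (z i : nat) : bool := odd (z %/ 2 ^ i).
(** Mixed-radix position in the table of values; the factor 5 is the number of modes [m], and the
    code [c] is the leading digit. *)
Definition idx (n c m x y : nat) : nat := ((c * 5 + m) * n + x) * n + y.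
Definition look (n h i c m x y : nat) : nat := cfst (iter (i.-1 - idx n c m x y) csnd h).
Definition var_val (k x y : nat) : nat := if k == 0 then x else y.
Definition pos_part (z : nat) : nat := if odd z then 0 else z %/ 2.
Definition neg_part (z : nat) : nat := if odd z then (z %/ 2).+1 else 0.

Definition atom_val (n u b a x y : nat) : bool :=
  if cfst a == 0 then bit u (cfst (csnd a) * n + var_val (csnd (csnd a)) x y)
  else bit b ((cfst (csnd a) * n + var_val (cfst (csnd (csnd a))) x y) * n
              + var_val (csnd (csnd (csnd a))) x y).

Definition cmp_val (k e a b : nat) : bool :=
  if k == 0 then a == b else if k == 1 then a != b else if k == 2 then a <= b
  else if k == 3 then b <= a else if k == 4 then a < b else if k == 5 then b < a
  else if k == 6 then a %% e == b %% e else a %% e != b %% e.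

Definition quant_val (n u b h i d x y : nat) (neg : bool) : bool :=
  bex n (fun p => bex n (fun q =>
    atom_val n u b (cfst (csnd (csnd d)))
      (if cfst d == 0 then x else p) (if cfst (csnd d) == 0 then y else q) &&
    (if neg then look n h i (csnd (csnd (csnd d))) 0
      (if cfst d == 0 then x else p) (if cfst (csnd d) == 0 then y else q) == 0
     else 0 < look n h i (csnd (csnd (csnd d))) 0
      (if cfst d == 0 then x else p) (if cfst (csnd d) == 0 then y else q)))).

(** Negative parts are moved to the opposite side of the comparison, so that only natural numbers
    are compared. *)
Definition pres_val (n h i d x y : nat) : bool :=
  cmp_val (cfst (cfst (csnd (csnd d)))) (csnd (cfst (csnd (csnd d))))
    (look n h i (cfst (csnd d)) (2 * cfst d).+1 x y + neg_part (csnd (csnd (csnd d))))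
    (look n h i (cfst (csnd d)) (2 * cfst d).+2 x y + pos_part (csnd (csnd (csnd d)))).

Definition fml_step (n u b h i c x y : nat) : bool :=
  if cfst c == 0 then atom_val n u b (csnd c) x y
  else if cfst c == 1 then var_val (cfst (csnd c)) x y == var_val (csnd (csnd c)) x y
  else if cfst c == 2 then look n h i (csnd c) 0 x y == 0
  else if cfst c == 3 then
    (0 < look n h i (cfst (csnd c)) 0 x y) && (0 < look n h i (csnd (csnd c)) 0 x y)
  else if cfst c == 4 then
    (0 < look n h i (cfst (csnd c)) 0 x y) || (0 < look n h i (csnd (csnd c)) 0 x y)
  else if cfst c == 5 then quant_val n u b h i (csnd c) x y false
  else if cfst c == 6 then ~~ quant_val n u b h i (csnd c) x y true
  else pres_val n h i (csnd c) x y.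

Definition term_count (n b h i c m x y : nat) : nat :=
  bsum n (fun p =>
    bit b (if cfst (csnd (csnd c)) == 0
           then (cfst (csnd c) * n + var_val (m.-1 %/ 2) x y) * n + p
           else (cfst (csnd c) * n + p) * n + var_val (m.-1 %/ 2) x y) &&
    (0 < look n h i (cfst (csnd (csnd (csnd c)))) 0
           (var_val (m.-1 %/ 2) x p) (var_val (m.-1 %/ 2) p y))).

Definition ts_step (n b h i c m x y : nat) : nat :=
  if c == 0 then 0
  else (if odd m then pos_part (cfst c.-1) else neg_part (cfst c.-1)) *
       term_count n b h i c.-1 m x y +
       look n h i (csnd (csnd (csnd (csnd c.-1)))) m x y.

(* Mode [m = 0] is the truth value of the formula coded by [c]; modes 1 and 2 (resp. 3 and 4) sum
   the positive and the negative coefficients of a term list whose free variable is x (resp. y). *)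
Definition step (n u b h i c m x y : nat) : nat :=
  if m == 0 then nat_of_bool (fml_step n u b h i c x y) else ts_step n b h i c m x y.

Definition entry (n u b h i : nat) : nat :=
  step n u b h i (i %/ n %/ n %/ 5) (i %/ n %/ n %% 5) (i %/ n %% n) (i %% n).

(* Course-of-values recursion: [hist] is the coded list of all earlier entries, latest first. *)
Definition hist (n u b i : nat) : nat :=
  iteri i (fun j h => cpair (entry n u b h j) h) 0.

Definition val_at (n u b c m x y : nat) : nat := cfst (hist n u b (idx n c m x y).+1).

(** Relation symbols in a formula have numbers at most its code, so [c.+1] bit tables of each arity
    describe a structure on [n] elements. For a sentence the assignment is arbitrary, and 0 is
    taken. *)
Definition search (c : nat) : bool :=
  bex (model_bound c).+1 (fun n =>
    bex (2 ^ (c.+1 * n)) (fun u => bex (2 ^ (c.+1 * n * n)) (fun b =>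
      (0 < n) && (0 < val_at n u b c 0 0 0)))).

(** * Recursiveness of the search *)

Lemma pr_app4 (f : nat -> nat -> nat -> nat -> nat) :
  pr 4 (fun xs => f (nth 0 xs 0) (nth 0 xs 1) (nth 0 xs 2) (nth 0 xs 3)) ->
  forall k A B C D, pr k A -> pr k B -> pr k C -> pr k D ->
  pr k (fun xs => f (A xs) (B xs) (C xs) (D xs)).
Proof. by move=> hf k A B C D *; apply: (@pr_comp k _ [:: A; B; C; D] hf). Qed.

Lemma pr_app5 (f : nat -> nat -> nat -> nat -> nat -> nat) :
  pr 5 (fun xs => f (nth 0 xs 0) (nth 0 xs 1) (nth 0 xs 2) (nth 0 xs 3) (nth 0 xs 4)) ->
  forall k A B C D E, pr k A -> pr k B -> pr k C -> pr k D -> pr k E ->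
  pr k (fun xs => f (A xs) (B xs) (C xs) (D xs) (E xs)).
Proof. by move=> hf k A B C D E *; apply: (@pr_comp k _ [:: A; B; C; D; E] hf). Qed.

Lemma pr_app9 (f : nat -> nat -> nat -> nat -> nat -> nat -> nat -> nat -> nat -> nat) :
  pr 9 (fun xs => f (nth 0 xs 0) (nth 0 xs 1) (nth 0 xs 2) (nth 0 xs 3) (nth 0 xs 4)
                    (nth 0 xs 5) (nth 0 xs 6) (nth 0 xs 7) (nth 0 xs 8)) ->
  forall k A B C D E F G H I, pr k A -> pr k B -> pr k C -> pr k D -> pr k E ->
  pr k F -> pr k G -> pr k H -> pr k I ->
  pr k (fun xs => f (A xs) (B xs) (C xs) (D xs) (E xs) (F xs) (G xs) (H xs) (I xs)).
Proof.
by move=> hf k A B C D E F G H I *; apply: (@pr_comp k _ [:: A; B; C; D; E; F; G; H; I] hf).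
Qed.

Lemma pr_step : pr 9 (fun xs => step (nth 0 xs 0) (nth 0 xs 1) (nth 0 xs 2) (nth 0 xs 3)
  (nth 0 xs 4) (nth 0 xs 5) (nth 0 xs 6) (nth 0 xs 7) (nth 0 xs 8)).
Proof.
rewrite /step /ts_step /term_count /fml_step /pres_val /quant_val /cmp_val /atom_val.
rewrite /neg_part /pos_part /var_val /look /idx /bit.
by prs.
Qed.

Lemma pr_entry : pr 5 (fun xs => entry (nth 0 xs 0) (nth 0 xs 1) (nth 0 xs 2) (nth 0 xs 3) (nth 0 xs 4)).
Proof. by rewrite /entry; apply: (pr_app9 pr_step); prs. Qed.

Lemma pr_hist k A B C D : pr k A -> pr k B -> pr k C -> pr k D ->
  pr k (fun xs => hist (A xs) (B xs) (C xs) (D xs)).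
Proof.
apply: (@pr_app4 hist); rewrite /hist.
apply: (@pr_rec 4 (fun xs => nth 0 xs 3) (fun=> 0)
  (fun j h xs => cpair (entry (nth 0 xs 0) (nth 0 xs 1) (nth 0 xs 2) h j) h)); prs.
by apply: (pr_app5 pr_entry); prs.
Qed.

Lemma pr_val_at k A B C D : pr k A -> pr k B -> pr k C -> pr k D ->
  pr k (fun xs => val_at (A xs) (B xs) (C xs) (D xs) 0 0 0).
Proof.
apply: (@pr_app4 (fun n u b c => val_at n u b c 0 0 0)); rewrite /val_at /idx.
by prs; apply: pr_hist; prs.
Qed.

Lemma pr_zs_bound k A B : pr k A -> pr k B -> pr k (fun xs => zs_bound (A xs) (B xs)).
Proof.
apply: (@pr_app2 zs_bound).
apply: pr_ext (@pr_rec 2 (fun xs => nth 0 xs 0) (fun=> 1)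
  (fun _ r xs => r * (2 * (r * nth 0 xs 1) + 1)) _ _ _) => [xs _|||]; prs.
by elim: (nth 0 xs 0) => //= n ->.
Qed.

Lemma pr_model_bound k A : pr k A -> pr k (fun xs => model_bound (A xs)).
Proof.
apply: (@pr_app1 model_bound); rewrite /model_bound; cbv zeta.
by repeat (prs; try (match goal with
  |- pr _ (fun xs => zs_bound (@?A xs) (@?B xs)) => refine (@pr_zs_bound _ A B _ _) end)).
Qed.

Lemma pr_search : pr 1 (fun xs => search (nth 0 xs 0)).
Proof.
rewrite /search; prs; first exact/pr_model_bound/pr_var.
by apply: pr_val_at; prs.
Qed.

(** * Correctness of the evaluator *)

#[local] Arguments look : simpl never.
#[local] Arguments hist : simpl never.
#[local] Arguments idx : simpl never.
#[local] Arguments val_at : simpl never.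

Lemma hist_lookup n u b i k : k < i ->
  cfst (iter (i.-1 - k) csnd (hist n u b i)) = cfst (hist n u b k.+1).
Proof.
elim: i => // i IH; rewrite ltnS leq_eqVlt => /orP[/eqP->|ki]; first by rewrite subnn.
rewrite -IH // (_ : i.+1.-1 - k = (i.-1 - k).+1); last by lia.
by rewrite iterSr /= cpairK2.
Qed.

Section Decode.
Variables (n u b : nat).
Hypothesis n_gt0 : 0 < n.

Lemma val_atE c m x y : m < 5 -> x < n -> y < n ->
  val_at n u b c m x y = step n u b (hist n u b (idx n c m x y)) (idx n c m x y) c m x y.
Proof.
move=> m5 xn yn; rewrite /val_at /= cpairK1 /entry.
have d1 : idx n c m x y %/ n = (c * 5 + m) * n + x.
  by rewrite /idx divnMDl // divn_small // addn0.
have d2 : idx n c m x y %/ n %/ n = c * 5 + m.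
  by rewrite d1 divnMDl // divn_small // addn0.
rewrite d2 d1 divnMDl // (divn_small m5) addn0 !modnMDl !modn_small //.
Qed.

(** Codes of subformulas are smaller and the code is the leading digit of [idx], so the entry has
    already been computed. *)
Lemma look_val_at c m x y c' m' x' y' : c' < c -> m' < 5 -> x' < n -> y' < n ->
  look n (hist n u b (idx n c m x y)) (idx n c m x y) c' m' x' y' = val_at n u b c' m' x' y'.
Proof.
move=> cc m5 xn yn; rewrite /look hist_lookup //.
rewrite {1}/idx; have h1 : (c' * 5 + m').+1 <= c * 5 + m by lia.
have h2 : ((c' * 5 + m') * n + x').+1 <= (c * 5 + m) * n + x.
  apply: leq_trans (_ : (c' * 5 + m').+1 * n <= _); first by rewrite mulSn; lia.
  by apply: leq_trans (leq_addr _ _); rewrite leq_mul2r h1 orbT.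
apply: leq_trans (_ : ((c' * 5 + m') * n + x').+1 * n <= _); first by rewrite mulSn; lia.
by apply: leq_trans (leq_addr _ _); rewrite leq_mul2r h2 orbT.
Qed.

End Decode.

Section EvaluatorSpec.
Variables (V : finType) (n : nat) (r : V -> 'I_n).
Hypothesis r_bij : bijective r.
Variables (C u b : nat) (U : nat -> V -> bool) (B : nat -> V -> V -> bool).
Hypothesis U_bit : forall P a, P <= C -> U P a = bit u (P * n + r a).
Hypothesis B_bit : forall R a a', R <= C -> B R a a' = bit b ((R * n + r a) * n + r a').

Lemma bsum_bij (g : nat -> nat) : bsum n g = \sum_(a : V) g (r a).
Proof. by rewrite /bsum (reindex r) //; apply: onW_bij. Qed.

Lemma bex_bij (p : nat -> bool) : bex n p = [exists a : V, p (r a)].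
Proof.
have [r' rK r'K] := r_bij.
apply/bexP/existsP => [[i lt pi]|[a pa]]; last by exists (r a).
by exists (r' (Ordinal lt)); rewrite r'K.
Qed.

Lemma card_bsum (Q : pred V) (q : nat -> bool) : (forall a, Q a = q (r a)) ->
  #|Q| = bsum n (fun i => q i).
Proof.
move=> e; rewrite bsum_bij -sum1_card big_mkcond; apply: eq_bigr => a _.
by rewrite unfold_in e; case: (q _).
Qed.

Lemma pos_neg_code_int z : z = ((pos_part (code_int z))%:Z - (neg_part (code_int z))%:Z)%R.
Proof.
rewrite /pos_part /neg_part; case: z => k /=.
  by rewrite odd_double -muln2 mulnK // subr0.
by rewrite odd_double /= divn2 /= uphalf_double NegzE sub0r.
Qed.

Lemma atom_valE a (s : var -> V) : code_atom a <= C ->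
  atom_val n u b (code_atom a) (r (s vx)) (r (s vy)) = asat U B a s.
Proof.
have vvE v : var_val (code_var v) (r (s vx)) (r (s vy)) = r (s v) by case: v.
case: a => [P v|R v w] le; rewrite /atom_val /= !(cpairK1, cpairK2) /= !vvE.
  by rewrite U_bit //; have := cpair_ge 0 (cpair P (code_var v)); have := cpair_ge P (code_var v); move: le => /=; lia.
rewrite B_bit //; have := cpair_ge 1 (cpair R (cpair (code_var v) (code_var w))).
have := cpair_ge R (cpair (code_var v) (code_var w)); move: le => /=; lia.
Qed.

Lemma cmp_valE c (p q p' q' : nat) (x y : int) :
  x = (p%:Z - q%:Z)%R -> y = (p'%:Z - q'%:Z)%R ->
  cmp_val (cfst (code_cmp c)) (csnd (code_cmp c)) (p + q') (q + p') = cmp_holds c x y.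
Proof.
move=> -> ->.
have modE d : (p + q' == q + p' %[mod d]) = (p%:Z - q%:Z == p'%:Z - q'%:Z %[mod d])%Z.
  rewrite -eqz_nat -!modz_nat !eqz_mod_dvd !PoszD.
  by rewrite (_ : (p%:Z + q'%:Z - (q%:Z + p'%:Z) = p%:Z - q%:Z - (p'%:Z - q'%:Z))%R) //; ring.
case: c => [||||||d|d] /=; rewrite !(cpairK1, cpairK2) /cmp_val /=; try by lia.
- exact: modE.
- by rewrite modE.
Qed.

(** The numbering [r] stays general: the identity reads a structure off the bit tables, and
    [enum_rank] encodes a given model. *)
Lemma evaluator_spec :
  (forall f (s : var -> V), code f <= C ->
     val_at n u b (code f) 0 (r (s vx)) (r (s vy)) = sat U B f s) /\
  (forall ts v (s : var -> V), code_ts ts <= C ->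
     tsum U B v ts s =
     ((val_at n u b (code_ts ts) (2 * code_var v).+1 (r (s vx)) (r (s vy)))%:Z
      - (val_at n u b (code_ts ts) (2 * code_var v).+2 (r (s vx)) (r (s vy)))%:Z)%R).
Proof.
have rn a : r a < n := ltn_ord (r a).
have n_gt0 (s : var -> V) : 0 < n by apply: leq_trans (rn (s vx)).
apply: fml_sterm_ind.
- move=> a s /= le; have := cpair_ge 0 (code_atom a) => h.
  by rewrite val_atE ?(n_gt0 s) // /step /= /fml_step !(cpairK1, cpairK2) /= atom_valE //; lia.
- move=> v w s /= le; rewrite val_atE ?(n_gt0 s) // /step /= /fml_step !(cpairK1, cpairK2) /=.
  have vvE z : var_val (code_var z) (r (s vx)) (r (s vy)) = r (s z) by case: z.
  by rewrite !vvE; congr nat_of_bool; rewrite (inj_eq val_inj) (inj_eq (bij_inj r_bij)).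
- move=> g IH s /= le; have h := cpair_ge 2 (code g).
  rewrite val_atE ?(n_gt0 s) // /step /= /fml_step !(cpairK1, cpairK2) /=.
  rewrite look_val_at ?IH ?(n_gt0 s) //; try lia.
- move=> g IHg k IHk s /= le; have h := cpair_ge 3 (cpair (code g) (code k)); have h' := cpair_ge (code g) (code k).
  rewrite val_atE ?(n_gt0 s) // /step /= /fml_step !(cpairK1, cpairK2) /=.
  rewrite !look_val_at ?IHg ?IHk ?(n_gt0 s) //; try lia.
- move=> g IHg k IHk s /= le; have h := cpair_ge 4 (cpair (code g) (code k)); have h' := cpair_ge (code g) (code k).
  rewrite val_atE ?(n_gt0 s) // /step /= /fml_step !(cpairK1, cpairK2) /=.
  rewrite !look_val_at ?IHg ?IHk ?(n_gt0 s) //; try lia.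
- move=> qx qy a g IH s le.
  have h1 := cpair_ge 5 (cpair (code_bool qx) (cpair (code_bool qy) (cpair (code_atom a) (code g)))).
  have h2 := cpair_ge (code_bool qx) (cpair (code_bool qy) (cpair (code_atom a) (code g))).
  have h3 := cpair_ge (code_bool qy) (cpair (code_atom a) (code g)).
  have h4 := cpair_ge (code_atom a) (code g).
  move: le => /= le.
  rewrite val_atE ?(n_gt0 s) // /step /= /fml_step !(cpairK1, cpairK2) /=.
  rewrite /quant_val bex_bij; congr nat_of_bool; apply: eq_existsb => p.
  rewrite bex_bij; apply: eq_existsb => q.
  rewrite !(cpairK1, cpairK2).
  have Ex : (if code_bool qx == 0 then r (s vx) : nat else r p) = r (qupd qx qy s p q vx) by case: qx {h1 h2 le}.
  have Ey : (if code_bool qy == 0 then r (s vy) : nat else r q) = r (qupd qx qy s p q vy) by case: qy {h1 h2 h3 le Ex}.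
  rewrite Ex Ey atom_valE; last by lia.
  by rewrite look_val_at ?IH ?(n_gt0 s) //; lia.
- move=> qx qy a g IH s le.
  have h1 := cpair_ge 6 (cpair (code_bool qx) (cpair (code_bool qy) (cpair (code_atom a) (code g)))).
  have h2 := cpair_ge (code_bool qx) (cpair (code_bool qy) (cpair (code_atom a) (code g))).
  have h3 := cpair_ge (code_bool qy) (cpair (code_atom a) (code g)).
  have h4 := cpair_ge (code_atom a) (code g).
  move: le => /= le.
  rewrite val_atE ?(n_gt0 s) // /step /= /fml_step !(cpairK1, cpairK2) /=.
  rewrite /quant_val bex_bij negb_exists; congr nat_of_bool; apply: eq_forallb => p.
  rewrite bex_bij negb_exists; apply: eq_forallb => q.
  rewrite !(cpairK1, cpairK2).
  have Ex : (if code_bool qx == 0 then r (s vx) : nat else r p) = r (qupd qx qy s p q vx) by case: qx {h1 h2 le}.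
  have Ey : (if code_bool qy == 0 then r (s vy) : nat else r q) = r (qupd qx qy s p q vy) by case: qy {h1 h2 h3 le Ex}.
  rewrite Ex Ey atom_valE; last by lia.
  rewrite look_val_at ?IH ?(n_gt0 s) //; try lia.
- move=> v ts IH c d s le.
  have h1 := cpair_ge 7 (cpair (code_var v) (cpair (code_ts ts) (cpair (code_cmp c) (code_int d)))).
  have h2 := cpair_ge (code_var v) (cpair (code_ts ts) (cpair (code_cmp c) (code_int d))).
  have h3 := cpair_ge (code_ts ts) (cpair (code_cmp c) (code_int d)).
  move: le => /= le.
  rewrite val_atE ?(n_gt0 s) // /step /= /fml_step !(cpairK1, cpairK2) /=.
  rewrite /pres_val !(cpairK1, cpairK2) !look_val_at ?(n_gt0 s) //; try (by case: (v) => /=; lia); try lia.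
  congr nat_of_bool; apply: cmp_valE; last exact: pos_neg_code_int.
  by apply: IH; lia.
- move=> v s _ /=; rewrite !val_atE ?(n_gt0 s) //; try by case: v.
- move=> lam R i g IHg ts IHts v s le.
  have h1 := cpair_ge (code_int lam) (cpair R (cpair (code_bool i) (cpair (code g) (code_ts ts)))).
  have h2 := cpair_ge R (cpair (code_bool i) (cpair (code g) (code_ts ts))).
  have h3 := cpair_ge (code_bool i) (cpair (code g) (code_ts ts)).
  have h4 := cpair_ge (code g) (code_ts ts).
  move: le => /= le.
  set N := #|_|.
  have count_E m i0 c0 (m5 : m = (2 * code_var v).+1 \/ m = (2 * code_var v).+2) :
      code g < c0 -> i0 = idx n c0 m (r (s vx)) (r (s vy)) ->
      term_count n b (hist n u b i0) i0 (cpair (code_int lam) (cpair R (cpair (code_bool i) (cpair (code g) (code_ts ts))))) m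
        (r (s vx)) (r (s vy)) = N.
    move=> gc ->; rewrite /N /term_count !(cpairK1, cpairK2); symmetry; apply: card_bsum => a.
    have -> : m.-1 %/ 2 = code_var v by case: m5 => ->; case: (v).
    rewrite look_val_at ?(n_gt0 s) //; try by case: (v); rewrite /var_val /=.
    have -> : var_val (code_var v) (r (s vx)) (r a) = r (upd s (other v) a vx) by case: (v).
    have -> : var_val (code_var v) (r a) (r (s vy)) = r (upd s (other v) a vy) by case: (v).
    have -> : var_val (code_var v) (r (s vx)) (r (s vy)) = r (s v) by case: (v).
    rewrite IHg /=; last by lia.
    by rewrite !B_bit; [case: (i); case: (sat U B g _)|lia..].
  rewrite !val_atE ?(n_gt0 s) //; try by case: (v).
  rewrite /step /= /ts_step /= !oddM /=.
  have gc : code g < (cpair (code_int lam) (cpair R (cpair (code_bool i) (cpair (code g) (code_ts ts))))).+1 by lia.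
  rewrite (count_E _ _ _ (or_introl erefl) gc erefl) (count_E _ _ _ (or_intror erefl) gc erefl).
  rewrite !(cpairK1, cpairK2) !look_val_at ?(n_gt0 s) //; try (by case: (v)); try lia.
  rewrite IHts; last by lia.
  by rewrite {1}(pos_neg_code_int lam) !PoszD !PoszM; ring.
Qed.

End EvaluatorSpec.

(** * Correctness of the search *)

Lemma exists_bits k (g : nat -> bool) : exists2 z, z < 2 ^ k & forall i, i < k -> bit z i = g i.
Proof.
elim: k g => [|k IH] g; first by exists 0.
have [z zk zg] := IH (fun i => g i.+1).
exists (g 0 + z * 2) => [|[|i] ik].
- by rewrite expnS; case: (g 0); lia.
- by rewrite /bit divn1 oddD oddM /= andbF addbF; case: (g 0).
- rewrite -zg // /bit expnS divnMA; congr (odd (_ %/ _)).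
  by rewrite addnC divnMDl // divn_small ?addn0 //; case: (g 0).
Qed.

Lemma searchP f : gf2_sentence f -> reflect (fin_sat f) (search (code f)).
Proof.
move=> fS; apply: (iffP (bexP _ _)).
  move=> [[|n] _ /bexP[u _ /bexP[b _ /andP[// _ val_gt0]]]].
  pose U P (a : 'I_n.+1) := bit u (P * n.+1 + a).
  pose B R (a a' : 'I_n.+1) := bit b ((R * n.+1 + a) * n.+1 + a').
  exists 'I_n.+1, ord0, U, B.
  have idb : bijective (@id 'I_n.+1) by exists id.
  have [spec _] := @evaluator_spec 'I_n.+1 n.+1 id idb (code f) u b U B
    (fun _ _ _ => erefl) (fun _ _ _ _ => erefl).
  by have := spec f (fun=> ord0) (leqnn _); rewrite /= => e; rewrite e lt0b in val_gt0.
move=> /(small_model fS)[V [u0 [U [B [satf cardV]]]]].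
set n := #|V| in cardV.
have n_gt0 : 0 < n by apply/card_gt0P; exists u0.
pose elt k := nth u0 (enum V) k.
have eltE a : elt (enum_rank a) = a by rewrite /elt nth_enum_rank.
have rn a : enum_rank a < n := ltn_ord (enum_rank a).
(* Bit positions are decoded by quotient and remainder, inverting the layout read by [atom_val]. *)
have [u u_lt uE] := exists_bits ((code f).+1 * n) (fun i => U (i %/ n) (elt (i %% n))).
have [b b_lt bE] := exists_bits ((code f).+1 * n * n)
  (fun i => B (i %/ n %/ n) (elt (i %/ n %% n)) (elt (i %% n))).
have digit c k x : c < k -> x < n -> c * n + x < k * n.
  move=> ck xn; apply: leq_trans (_ : c.+1 * n <= _); first by rewrite mulSn; lia.
  by rewrite leq_mul2r ck orbT.
have qE c x : x < n -> (c * n + x) %/ n = c by move=> xn; rewrite divnMDl // divn_small ?addn0.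
have mE c x : x < n -> (c * n + x) %% n = x by move=> xn; rewrite modnMDl modn_small.
exists n => //; apply/bexP; exists u => //; apply/bexP; exists b => //.
rewrite n_gt0 /=; have rb : bijective (@enum_rank V).
  by exists enum_val; [apply: enum_rankK|apply: enum_valK].
have [||spec _] := @evaluator_spec V n (@enum_rank V) rb (code f) u b U B.
- by move=> P a PC; rewrite uE ?digit // qE // mE // eltE.
- by move=> R a a' RC; rewrite bE ?digit // !qE // !mE // !eltE.
have := spec f (fun=> enum_val (Ordinal n_gt0)) (leqnn _); rewrite /= enum_valK /= => ->.
rewrite lt0b; move: satf; congr is_true; apply: sat_fv => v fv_v.
by case/and3P: fS => _ nx ny; case: v fv_v => h; [rewrite h in nx|rewrite h in ny].
Qed.

(* There is a (total on sentences) mu-recursive decision procedure for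
   finite satisfiability of GF^2_pres sentences. *)
Theorem mainTheorem11 :
  exists dec : rf, forall f : fml, gf2_sentence f ->
    (fin_sat f -> eval dec [:: code f] 1) /\
    (~ fin_sat f -> eval dec [:: code f] 0).
Proof.
have [dec decE] := pr_search; exists dec => f fS.
have := decE [:: code f] erefl; rewrite /=.
by case: (searchP fS) => h; split.
Qed.
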